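(* Let $E$ be a reflexive rearrangement-invariant function space on $[0,1]$ and let $T:E\to E$ be a bounded linear operator. Then $T$ is narrow if and only if $T^*(B(E^* ))$ is a poor subset of $E^*$, where $B(E^* )$ denotes the closed unit ball of $E^*$ and $T^*$ the conjugate (adjoint) operator.
   Context: $\mu$ is Lebesgue measure on $[0,1]$. A Köthe function space $X$ on $([0,1],\mu)$ is a Banach space of (classes of) locally integrable Borel functions such that (1) if $|f|\le|g|$ a.e. and $g\in X$ then $f\in X$ and $\|f\|_X\le\|g\|_X$; (2) $\chi_A\in X$ for every Borel set $A$ of finite measure. $X$ is order-continuous if $f_n\downarrow 0$ a.e. with $f_n\in X$ implies $\|f_n\|_X\downarrow0$ (equivalently here, the norm is absolutely continuous); it has the Fatou property if $0\le f_n\in X$, $\sup_n\|f_n\|_X<\infty$, $f_n\uparrow f$ a.e. imply $f\in X$ and $\|f\|_X=\sup_n\|f_n\|_X$. A rearrangement-invariant (r.i.) space is a Köthe function space $X$ on $([0,1],\mu)$ such that: (1) $X$ is order-continuous or has the Fatou property; (2) for every measure-preserving invertible Borel automorphism $\tau$ of $[0,1]$, $f\in X$ iff $f\circ\tau\in X$, and then $\|f\|_X=\|f\circ\tau\|_X$; (3) $\|\chi_{[0,1]}\|_X=1$. For a reflexive r.i. space $E$ the dual $E^*$ is identified with an r.i. space of functions via the pairing $f(x)=\int_{[0,1]} f x\,d\mu$. An operator $T:E\to E$ is narrow if for each measurable set $A$ and each $\varepsilon>0$ there is $x\in E$ with $x^2=\chi_A$, $\int x\,d\mu=0$ and $\|Tx\|<\varepsilon$.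 A subset $M$ of an r.i. space with absolutely continuous norm is poor if for each measurable $A\subseteq[0,1]$ and each $\varepsilon>0$ there is a decomposition $A=A^+\sqcup A^-$ into disjoint measurable subsets such that $\left|\int_{A^+}f\,d\mu-\int_{A^-}f\,d\mu\right|<\varepsilon$ for every $f\in M$. *)

(* Defs.v *)
From HB Require Import structures.
From mathcomp Require Import all_boot all_order all_algebra.
From mathcomp Require Import all_classical all_reals all_analysis.

Set Implicit Arguments.
Unset Strict Implicit.
Unset Printing Implicit Defensive.

Import Order.TTheory GRing.Theory Num.Theory.
Import numFieldNormedType.Exports.

Local Open Scope classical_set_scope.
Local Open Scope ring_scope.

Notation unit_itv R := (`[0%R, 1%R]%classic : set R).

(** A space of classes of functions on [0,1] is a normed space [X] with a map
    [rep : X -> R -> R] choosing a function in the class of each vector. Only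
    the values on [0,1], up to Lebesgue-null sets, are meaningful. *)

Definition ae_eq01 (R : realType) (f g : R -> R) : Prop :=
  f = g %[ae lebesgue_measure in unit_itv R].

Definition ae_le01 (R : realType) (f g : R -> R) : Prop :=
  \forall t \ae lebesgue_measure, unit_itv R t -> f t <= g t.

(** [f] belongs to the function space [X]. *)
Definition inX (R : realType) (X : Type) (rep : X -> R -> R) (f : R -> R) : Prop :=
  exists x : X, ae_eq01 (rep x) f.

(** Koethe function spaces over ([0,1], Lebesgue). The measure is finite, so
    local integrability is integrability on [0,1]. *)
Record is_kothe (R : realType) (X : completeNormedModType R)
    (rep : X -> R -> R) : Prop := IsKothe {
  kothe_integrable : forall x : X,
    lebesgue_measure.-integrable (unit_itv R) (EFin \o rep x);
  kothe_linear : forall (a : R) (x y : X),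
    ae_eq01 (rep (a *: x + y)) (fun t => a * rep x t + rep y t);
  kothe_inj : forall x y : X, ae_eq01 (rep x) (rep y) -> x = y;
  kothe_ideal : forall (f : R -> R) (y : X),
    measurable_fun (unit_itv R) f ->
    ae_le01 (fun t => `|f t|) (fun t => `|rep y t|) ->
    exists x : X, ae_eq01 (rep x) f /\ `|x| <= `|y|;
  kothe_indic : forall A : set R,
    measurable A -> A `<=` unit_itv R -> inX rep (\1_A : R -> R)
}.

Definition order_continuous (R : realType) (X : completeNormedModType R)
    (rep : X -> R -> R) : Prop :=
  forall u : nat -> X,
    (\forall t \ae lebesgue_measure, unit_itv R t ->
       nonincreasing_seq (fun n => rep (u n) t) /\
       rep (u n) t @[n --> \oo] --> (0 : R)) ->
    nonincreasing_seq (fun n => `|u n|) /\ `|u n| @[n --> \oo] --> (0 : R).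

Definition fatou_property (R : realType) (X : completeNormedModType R)
    (rep : X -> R -> R) : Prop :=
  forall (u : nat -> X) (f : R -> R),
    (forall n, ae_le01 (fun=> 0) (rep (u n))) ->
    has_ubound (range (fun n => `|u n|)) ->
    measurable_fun (unit_itv R) f ->
    (\forall t \ae lebesgue_measure, unit_itv R t ->
       nondecreasing_seq (fun n => rep (u n) t) /\
       rep (u n) t @[n --> \oo] --> f t) ->
    exists x : X, ae_eq01 (rep x) f /\ `|x| = sup (range (fun n => `|u n|)).

(** Measure-preserving invertible Borel automorphisms of [0,1]. *)
Record mp_automorphism (R : realType) (tau : R -> R) : Prop := MpAutomorphism {
  mpa_bij : set_bij (unit_itv R) (unit_itv R) tau;
  mpa_measurable : measurable_fun (unit_itv R) tau;
  mpa_inv_measurable : forall A : set R,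
    measurable A -> A `<=` unit_itv R -> measurable (tau @` A);
  mpa_preserving : forall A : set R,
    measurable A -> A `<=` unit_itv R ->
    lebesgue_measure (unit_itv R `&` tau @^-1` A) = lebesgue_measure A
}.

Record is_ri (R : realType) (X : completeNormedModType R)
    (rep : X -> R -> R) : Prop := IsRi {
  ri_kothe : is_kothe rep;
  ri_oc_or_fatou : order_continuous rep \/ fatou_property rep;
  ri_mem : forall tau f : R -> R,
    mp_automorphism tau -> measurable_fun (unit_itv R) f ->
    (inX rep f <-> inX rep (f \o tau));
  ri_norm : forall (tau : R -> R) (x y : X),
    mp_automorphism tau -> ae_eq01 (rep y) (rep x \o tau) -> `|x| = `|y|;
  ri_norm1 : forall x : X, ae_eq01 (rep x) \1_(unit_itv R) -> `|x| = 1
}.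

Record riSpace (R : realType) := RiSpace {
  ri_sort :> completeNormedModType R;
  ri_fun : ri_sort -> R -> R;
  ri_spaceP : is_ri ri_fun
}.

Definition topdual (R : realType) (X : normedModType R) : set (X -> R^o) :=
  [set phi | linear phi /\ continuous phi].
Arguments topdual {R} X _.

Definition dual_norm (R : realType) (X : normedModType R) (phi : X -> R^o) : R :=
  sup [set `|phi x| | x in [set x : X | `|x| <= 1]].

Definition dual_ball (R : realType) (X : normedModType R) : set (X -> R^o) :=
  [set phi | topdual X phi /\ dual_norm phi <= 1].
Arguments dual_ball {R} X _.

(** Surjectivity of the canonical embedding of [X] into its bidual; a bounded
    functional on the dual is given by a map [Psi] of which only the values on
    [topdual X] matter. *)
Definition reflexive_space (R : realType) (X : normedModType R) : Prop :=
  forall Psi : (X -> R^o) -> R,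
    (forall (a : R) (phi psi : X -> R^o), topdual X phi -> topdual X psi ->
       Psi (a *: phi + psi) = a * Psi phi + Psi psi) ->
    (exists C : R, forall phi, topdual X phi -> `|Psi phi| <= C * dual_norm phi) ->
    exists x : X, forall phi, topdual X phi -> Psi phi = phi x.

Definition adjoint (R : realType) (X : normedModType R) (T : X -> X)
  (phi : X -> R^o) : X -> R^o := phi \o T.

(** [g] is the function identified with [phi] by the integral pairing. *)
Definition pairing_repr (R : realType) (E : riSpace R) (phi : E -> R^o)
    (g : R -> R) : Prop :=
  measurable_fun (unit_itv R) g /\
  forall x : E,
    lebesgue_measure.-integrable (unit_itv R)
      (EFin \o (fun t => g t * ri_fun x t)) /\
    phi x = \int[lebesgue_measure]_(t in unit_itv R) (g t * ri_fun x t).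

(** A set of functionals viewed as a set of functions. *)
Definition as_functions (R : realType) (E : riSpace R) (M : set (E -> R^o)) :
    set (R -> R) :=
  [set g | exists2 phi, M phi & pairing_repr phi g].

Definition narrow (R : realType) (E : riSpace R) (T : E -> E) : Prop :=
  forall (A : set R) (eps : R),
    measurable A -> A `<=` unit_itv R -> 0 < eps ->
    exists x : E,
      [/\ ae_eq01 (fun t => ri_fun x t ^+ 2) \1_A,
          \int[lebesgue_measure]_(t in unit_itv R) ri_fun x t = 0
        & `|T x| < eps].

Definition poor (R : realType) (M : set (R -> R)) : Prop :=
  forall (A : set R) (eps : R),
    measurable A -> A `<=` unit_itv R -> 0 < eps ->
    exists Ap Am : set R,
      [/\ measurable Ap, measurable Am, Ap `&` Am = set0, A = Ap `|` Am
        & forall f, M f ->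
          `| \int[lebesgue_measure]_(t in Ap) f t
             - \int[lebesgue_measure]_(t in Am) f t | < eps].

(* Main.v *)
Require Import Defs.
From HB Require Import structures.
From mathcomp Require Import all_boot all_order all_algebra.
From mathcomp Require Import all_classical all_reals all_analysis.
From mathcomp Require Import measurable_realfun lra.
Import Order.TTheory GRing.Theory Num.Theory.
Import numFieldNormedType.Exports.

(** If [x] is a sign on [A] with [|T x| < eps] and [phi] is in the dual ball, the
    function [g] of the functional [phi o T] satisfies [int g x = phi (T x)], so
    the sets where [x] is [1] and [-1] split [A] as poorness requires.

    For the converse, reflexivity makes the norm order-continuous: if [u_n]
    decreases to [0] a.e. but [|u_n| >= e], Hahn-Banach gives a [phi] with
    [phi u_n >= e], while for every functional [psi] the sequence [psi u_n] has
    bounded variation; its limit is an element of the bidual, hence of the space,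
    and testing against integrals shows that this element is [0]. By
    Radon-Nikodym every functional is then an integral, and norming functionals
    turn poorness into: every [B] carries a sign [x] with [T x] small. To get
    mean zero, reserve a subset [D] of [A] of positive measure whose indicator
    has small norm, cut the rest of [A] into pieces of measure at most that of
    [D], orient the sign on each piece so that the total imbalance stays below
    the measure of [D], and compensate it inside [D]. *)

Set Implicit Arguments.
Unset Strict Implicit.
Unset Printing Implicit Defensive.

Local Open Scope classical_set_scope.
Local Open Scope ring_scope.

(** * Hahn-Banach *)

Section Sublinear.
Context {R : realType} {V : lmodType R}.
Implicit Types (p q : V -> R) (C : set V).

(** Homogeneity is only an inequality for positive scalars, the form that is easiest to verify for
    infima; applying it to [a^-1] as well recovers equality. *)
Definition sublinear q :=
  (forall x y, q (x + y) <= q x + q y) /\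
  (forall a x, 0 < a -> q (a *: x) <= a * q x).

Lemma sublinearZ q a x : sublinear q -> 0 < a -> q (a *: x) = a * q x.
Proof.
move=> [_ qZ] a0; apply/eqP; rewrite eq_le qZ//=.
have := qZ a^-1 (a *: x); rewrite invr_gt0 scalerA mulVf ?gt_eqF// scale1r.
by move=> /(_ a0); rewrite ler_pdivlMl.
Qed.

Lemma sublinear0 q : sublinear q -> q 0 = 0.
Proof.
by move=> qs; have := sublinearZ 0 qs (ltr0n _ 2); rewrite scaler0; lra.
Qed.

Lemma sublinear_geN q x : sublinear q -> - q (- x) <= q x.
Proof.
by move=> qs; have := qs.1 x (- x); rewrite subrr (sublinear0 qs); lra.
Qed.

Definition inf_fun (S : set (V -> R)) (x : V) := inf [set f x | f in S].

Lemma inf_fun_le (S : set (V -> R)) (l f : V -> R) :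
  (forall h x, S h -> l x <= h x) -> S f -> forall x, inf_fun S x <= f x.
Proof.
move=> lS Sf x; apply: ge_inf; last by exists f.
by exists (l x) => _ [h Sh <-]; exact: lS.
Qed.

(** The lower bound [l] keeps the infima away from the default value of [inf]. The domination
    hypotheses allow [k] to vary with the points, which covers both the family of [sublinear_push]
    and the chains in Zorn's lemma. *)
Lemma sublinear_inf_fun (S : set (V -> R)) (l : V -> R) :
  S !=set0 -> (forall h x, S h -> l x <= h x) ->
  (forall f h x y, S f -> S h -> exists2 k, S k & k (x + y) <= f x + h y) ->
  (forall f a x, S f -> 0 < a -> exists2 k, S k & k (a *: x) <= a * f x) ->
  sublinear (inf_fun S).
Proof.
move=> [f0 Sf0] lS SD SZ.
have S0 x : [set f x | f in S] !=set0 by exists (f0 x), f0.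
have leS := inf_fun_le lS.
split=> [x y|a x a0].
  rewrite -lerBlDr; apply: lb_le_inf => // _ [f Sf <-].
  rewrite lerBlDr -lerBlDl; apply: lb_le_inf => // _ [h Sh <-].
  rewrite lerBlDl; have [k Sk] := SD f h x y Sf Sh; apply: le_trans.
  exact: leS.
rewrite -ler_pdivrMl//; apply: lb_le_inf => // _ [f Sf <-].
rewrite ler_pdivrMl//; have [k Sk] := SZ f a x Sf a0; apply: le_trans.
exact: leS.
Qed.

Definition is_convex C :=
  forall a u v, 0 <= a <= 1 -> C u -> C v -> C (a *: u + (1 - a) *: v).

(* The infimum over [t >= 0] and [u] in [C] of [q (z + t u) - t c] is finite and
   sublinear because [C] is convex and [q >= c] on it. *)
Lemma sublinear_push q C c : sublinear q -> C !=set0 -> is_convex C ->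
  (forall u, C u -> c <= q u) ->
  exists q', [/\ sublinear q', forall x, q' x <= q x
    & forall u, C u -> q' (- u) <= - c].
Proof.
move=> qs [u0 Cu0] Cc qC.
pose S := [set f | exists t u, [/\ 0 <= t, C u &
                      f = fun z => q (z + t *: u) - t * c]].
have qZ t u : 0 <= t -> C u -> t * c <= q (t *: u).
  rewrite le_eqVlt => /predU1P[<-|t0] Cu.
    by rewrite mul0r scale0r sublinear0.
  by rewrite sublinearZ// ler_pM2l// qC.
(* Subadditivity gives [q (x + t *: u) + q (- x) >= q (t *: u) >= t * c]. *)
have lS h x : S h -> - q (- x) <= h x.
  move=> [t [u [t0 Cu ->]]]; have := qs.1 (x + t *: u) (- x).
  by rewrite addrAC subrr add0r; have := qZ _ _ t0 Cu; lra.
exists (inf_fun S); split.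
- apply: (sublinear_inf_fun (l := fun x => - q (- x))) => //.
  + by exists (fun z => q (z + 0 *: u0) - 0 * c), 0, u0.
  + move=> _ _ x y [t [u [t0 Cu ->]]] [s [v [s0 Cv ->]]].
    (* [w] is the convex combination of [u] and [v] with weights proportional to [t] and [s]; when
       both weights vanish any point of [C] will do. *)
    have [w Cw E] : exists2 w, C w & (t + s) *: w = t *: u + s *: v.
      have [ts0|ts0] := eqVneq (t + s) 0.
        exists u => //; have [-> ->] : t = 0 /\ s = 0 by split; lra.
        by rewrite addr0 !scale0r addr0.
      exists ((t / (t + s)) *: u + (1 - t / (t + s)) *: v).
        apply: Cc => //.
        by rewrite divr_ge0 ?addr_ge0//= ler_pdivrMr ?mul1r; lra.
      rewrite scalerDr !scalerA mulrCA divff// mulr1 mulrBr mulr1.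
      by rewrite mulrCA divff// mulr1 addrAC subrr add0r.
    exists (fun z => q (z + (t + s) *: w) - (t + s) * c).
      by exists (t + s), w; rewrite addr_ge0.
    by rewrite E addrACA; have := qs.1 (x + t *: u) (y + s *: v); lra.
  + move=> _ a x [t [u [t0 Cu ->]]] a0.
    exists (fun z => q (z + (a * t) *: u) - a * t * c).
      by exists (a * t), u; rewrite mulr_ge0// ltW.
    by rewrite -scalerA -scalerDr sublinearZ// mulrBr mulrA.
(* The member with [t = 0] is [q] itself; the one with [t = 1], evaluated at [- u], gives the last
   bound. *)
- move=> x; apply: (le_trans (inf_fun_le lS _ x)).
    by exists 0, u0; split=> //.
  by rewrite scale0r addr0 mul0r subr0.
- move=> u Cu; apply: (le_trans (inf_fun_le lS _ (- u))).
    by exists 1, u; split=> //.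
  by rewrite scale1r addNr sublinear0// mul1r sub0r.
Qed.

(* Pushing [q] along the singleton [y] with [c = q y] forces [q (- y) = - q y]. *)
Lemma minimal_sublinear_linear q : sublinear q ->
  (forall q', sublinear q' -> (forall x, q' x <= q x) -> q' = q) ->
  linear (q : V -> R^o).
Proof.
move=> qs qmin.
have qN y : q (- y) = - q y.
  have := @sublinear_push q [set y] (q y) qs.
  case => [||_ ->//|q' [q's q'q q'y]]; first by exists y.
    by move=> a u v _ -> ->; rewrite -scalerDl addrCA subrr addr0 scale1r.
  have E := qmin _ q's q'q; have := q'y y erefl; rewrite E.
  by have := sublinear_geN y qs; lra.
have qD x y : q (x + y) = q x + q y.
  by have := qs.1 x y; have := qs.1 (x + y) (- y); rewrite addrK qN; lra.
move=> a x y; rewrite qD; congr (_ + _).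
have [a0|a0|->] := ltgtP a 0; last by rewrite !scale0r sublinear0.
  rewrite -[a]opprK scaleNr qN sublinearZ ?oppr_gt0//.
  by rewrite scaleNr.
by rewrite sublinearZ.
Qed.

(** Instead of extending functionals from subspaces, Zorn's lemma is applied to the sublinear
    functions below [p]: a minimal one is linear. *)
Lemma hahn_banach p : sublinear p ->
  exists f : V -> R^o, linear f /\ forall x, f x <= p x.
Proof.
move=> ps.
pose P := {q : V -> R | sublinear q /\ forall x, q x <= p x}.
(* The order is reversed, so that a maximal element is a pointwise minimal function. *)
pose leP (q q' : P) := `[< forall x, sval q' x <= sval q x >].
have Pge (q : P) x : - p (- x) <= sval q x.
  case: q => q /= [qs qp]; apply: le_trans (sublinear_geN x qs).
  by rewrite lerN2.
have [| | |A Atot|[q [qs qp]] qmax] := @Zorn P leP.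
- by move=> q; apply/asboolP => x.
- move=> q r s /asboolP qr /asboolP rs; apply/asboolP => x.
  exact: le_trans (rs x) (qr x).
- move=> [q Pq] [r Pr] /asboolP/= qr /asboolP/= rq; apply: eq_exist.
  by apply/funext => x; apply/eqP; rewrite eq_le qr rq.
(* The empty chain is bounded by [p], a nonempty one by its pointwise infimum; of two members of a
   chain the smaller function serves as the witness for subadditivity. *)
- have [->|/set0P[q0 Aq0]] := eqVneq A set0.
    by exists (exist _ p (conj ps (fun x => lexx _))).
  pose S := [set sval q | q in A].
  have lS h x : S h -> - p (- x) <= h x by move=> [q _ <-].
  have ms : sublinear (inf_fun S).
    apply: (sublinear_inf_fun (l := fun x => - p (- x))) => //.
    + by exists (sval q0), q0.
    + move=> _ _ x y [q Aq <-] [r Ar <-].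
      have [/asboolP qr|/asboolP rq] := Atot q r Aq Ar.
        exists (sval r); first by exists r.
        by rewrite (le_trans ((proj2_sig r).1.1 x y))// lerD2r.
      exists (sval q); first by exists q.
      by rewrite (le_trans ((proj2_sig q).1.1 x y))// lerD2l.
    + move=> _ a x [q Aq <-] a0; exists (sval q); first by exists q.
      exact: (proj2_sig q).1.2.
  have mp x : inf_fun S x <= p x.
    apply: le_trans ((proj2_sig q0).2 x).
    by apply: (inf_fun_le lS); exists q0.
  exists (exist _ (inf_fun S) (conj ms mp)) => q Aq; apply/asboolP => x /=.
  by apply: (inf_fun_le lS); exists q.
- exists q; split => //; apply: minimal_sublinear_linear => // q' q's q'q.
  have q'p x : q' x <= p x := le_trans (q'q x) (qp x).
  have /(_ _) := qmax (exist _ q' (conj q's q'p)).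
  by move=> H; have := H (asboolT q'q) => /(congr1 sval).
Qed.

End Sublinear.

(** Pushing the norm along [C] yields a sublinear function that is at most [- c] on [- C]; any
    linear functional below it separates. A singleton [C] gives norming functionals. *)
Lemma convex_separation (R : realType) (X : normedModType R) (C : set X) (c : R) :
  C !=set0 -> is_convex C -> (forall u, C u -> c <= `|u|) ->
  exists phi : X -> R^o, [/\ linear phi, forall x, `|phi x| <= `|x|
    & forall u, C u -> c <= phi u].
Proof.
move=> C0 Cc Cn.
have ns : sublinear (fun x : X => `|x|).
  by split=> [|a x a0]; [exact: ler_normD|rewrite normrZ gtr0_norm].
have [q [qs qn qC]] := sublinear_push ns C0 Cc Cn.
have [f [fl fq]] := hahn_banach qs.
have fN x : f (- x) = - f x.
  by pose g := HB.pack f (GRing.isLinear.Build R X R^o *:%R f fl) :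
    {linear X -> R^o}; exact: (linearN g).
have fn x : f x <= `|x| := le_trans (fq x) (qn x).
exists f; split=> // [x|u Cu].
  by rewrite ler_norml fn andbT lerNl -fN -normrN fn.
by rewrite -lerN2 -fN (le_trans (fq _))// qC.
Qed.

(** * Koethe function spaces *)

Section TopDual.
Context {R : realType} {X : normedModType R}.
Implicit Types (phi : X -> R^o) (x : X).

Lemma topdual_linear phi : topdual X phi ->
  exists f : {linear X -> R^o}, phi = f.
Proof.
move=> [fl _].
by exists (HB.pack phi (GRing.isLinear.Build R X R^o *:%R phi fl) :
  {linear X -> R^o}).
Qed.

Lemma bounded_topdual phi C : linear phi -> (forall x, `|phi x| <= C * `|x|) ->
  topdual X phi.
Proof.
move=> fl fC; split => //.
pose f : {linear X -> R^o} :=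
  HB.pack phi (GRing.isLinear.Build R X R^o *:%R phi fl).
apply: (@bounded_linear_continuous _ _ _ f); apply/linear_boundedP.
apply: filterS (nbhs_pinfty_ge (num_real C)) => r Cr x.
by rewrite (le_trans (fC x))// ler_wpM2r.
Qed.

Lemma dual_norm_le phi C : 0 <= C -> (forall x, `|phi x| <= C * `|x|) ->
  dual_norm phi <= C.
Proof.
move=> C0 fC; apply: ge_sup; first by exists `|phi 0|, 0 => //=; rewrite normr0.
by move=> _ [x /= x1 <-]; rewrite (le_trans (fC x))// ler_piMr.
Qed.

Lemma topdual_bounded phi : topdual X phi ->
  exists2 C, 0 < C & forall x, `|phi x| <= C * `|x|.
Proof.
move=> dphi; have [f fE] := topdual_linear dphi.
have fc : continuous f by rewrite -fE; exact: dphi.2.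
have /linear_boundedP/pinfty_ex_gt0[C C0 fC] := (linear_bounded_continuous f).2 fc.
by exists C => //; rewrite fE.
Qed.

Lemma dual_norm_has_ubound phi : topdual X phi ->
  has_ubound [set `|phi x| | x in [set x : X | `|x| <= 1]].
Proof.
move=> /topdual_bounded[C C0 fC]; exists C => _ [y /= y1 <-].
by rewrite (le_trans (fC y))// ler_piMr// ltW.
Qed.

Lemma dual_norm_ge0 phi : topdual X phi -> 0 <= dual_norm phi.
Proof.
move=> dphi; apply: (ub_le_sup (dual_norm_has_ubound dphi)).
have [f ->] := topdual_linear dphi.
by exists 0; rewrite /= ?normr0// linear0 normr0.
Qed.

Lemma le_dual_norm phi x : topdual X phi -> `|phi x| <= dual_norm phi * `|x|.
Proof.
move=> dphi; have [f fE] := topdual_linear dphi.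
have [->|x0] := eqVneq x 0; first by rewrite fE linear0 !normr0 mulr0.
have nx0 : 0 < `|x| by rewrite normr_gt0.
rewrite -ler_pdivrMr//; apply: (ub_le_sup (dual_norm_has_ubound dphi)).
exists (`|x|^-1 *: x).
  by rewrite /= normrZ normfV normr_id mulVf// normr_eq0.
by rewrite fE linearZ/= normrM normfV normr_id mulrC.
Qed.

End TopDual.

(** * Almost-everywhere statements on the unit interval *)

Section Ae01.
Context {R : realType}.
Notation mu := (@lebesgue_measure R).
Notation I := (unit_itv R).
Implicit Types P Q S U : R -> Prop.

(** [ae_eq01] and [ae_le01] unfold to this shape, so the combinators below apply to them
    directly. *)
Definition ae01 P := \forall t \ae mu, I t -> P t.

Lemma ae01W P : (forall t, I t -> P t) -> ae01 P.
Proof. by move=> H; exact: (aeW mu H). Qed.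

Lemma ae01S P Q : (forall t, I t -> P t -> Q t) -> ae01 P -> ae01 Q.
Proof.
move=> PQ; apply: (@filterS _ _ (ae_filter_ringOfSetsType mu)) => t /= H It.
by apply: PQ => //; exact: H.
Qed.

Lemma ae01S2 P Q S : (forall t, I t -> P t -> Q t -> S t) ->
  ae01 P -> ae01 Q -> ae01 S.
Proof.
move=> PQS; apply: (@filterS2 _ _ (ae_filter_ringOfSetsType mu)) => t /= H H' It.
by apply: PQS => //; [exact: H|exact: H'].
Qed.

Lemma ae01S3 P Q S U : (forall t, I t -> P t -> Q t -> S t -> U t) ->
  ae01 P -> ae01 Q -> ae01 S -> ae01 U.
Proof.
move=> PQSU hP hQ; apply: ae01S2 (ae01S2 (fun t It => @conj _ _) hP hQ).
by move=> t It []; exact: PQSU.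
Qed.

Lemma ae01_forall (P : nat -> R -> Prop) :
  (forall n, ae01 (P n)) -> ae01 (fun t => forall n, P n t).
Proof.
move=> H; have /ae_foralln : forall n, \forall t \ae mu, I t -> P n t by [].
apply: (@filterS _ _ (ae_filter_ringOfSetsType mu)) => t /= Ht It n.
exact: Ht.
Qed.

End Ae01.

(** * Pointwise operations and the lattice norm *)

Section Koethe.
Context {R : realType} {X : completeNormedModType R} {rep : X -> R -> R}.
Hypothesis K : is_kothe rep.
Notation mu := (@lebesgue_measure R).
Notation I := (unit_itv R).
Implicit Types (x y : X) (f g : R -> R).

Lemma kothe_measurable x : measurable_fun I (rep x).
Proof. by apply/measurable_EFinP; exact: (measurable_int _ (kothe_integrable K x)). Qed.

Lemma repD x y : ae_eq01 (rep (x + y)) (rep x \+ rep y).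
Proof.
have := kothe_linear K 1 x y; rewrite scale1r; apply: ae01S => t _ ->.
by rewrite mul1r.
Qed.

Lemma rep0 : ae_eq01 (rep 0) (fun=> 0).
Proof.
have := kothe_linear K (-1) 0 0; rewrite scaler0 addr0; apply: ae01S => t _ ->.
by rewrite mulN1r addNr.
Qed.

Lemma repZ a x : ae_eq01 (rep (a *: x)) (fun t => a * rep x t).
Proof.
have := kothe_linear K a x 0; rewrite addr0.
by apply: ae01S2 rep0 => t _ H0 ->; rewrite H0 addr0.
Qed.

Lemma repB x y : ae_eq01 (rep (x - y)) (rep x \- rep y).
Proof.
have := repD x (- y); rewrite -scaleN1r.
by apply: ae01S2 (repZ (-1) y) => t _ H0 ->; rewrite /= H0 mulN1r.
Qed.

Lemma rep_sum (u : nat -> X) n :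
  ae_eq01 (rep (\sum_(0 <= i < n) u i)) (fun t => \sum_(0 <= i < n) rep (u i) t).
Proof.
elim: n => [|n IH].
  by rewrite big_geq//; apply: ae01S rep0 => t _ ->; rewrite big_geq.
have := repD (\sum_(0 <= i < n) u i) (u n).
rewrite big_nat_recr//=; apply: ae01S2 IH => t _ H1 ->.
by rewrite /= H1 big_nat_recr.
Qed.

Lemma inX_dominated f y : measurable_fun I f ->
  ae_le01 (fun t => `|f t|) (fun t => `|rep y t|) ->
  exists2 x, ae_eq01 (rep x) f & `|x| <= `|y|.
Proof. by move=> mf fy; have [x []] := kothe_ideal K mf fy; exists x. Qed.

(** The ideal axiom only bounds the norm of some vector in the class of [rep x]; injectivity of
    [rep] identifies that vector with [x]. *)
Lemma kothe_le_norm x y :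
  ae_le01 (fun t => `|rep x t|) (fun t => `|rep y t|) -> `|x| <= `|y|.
Proof.
move=> xy; have [z zx] := inX_dominated (kothe_measurable x) xy.
by rewrite (kothe_inj K zx).
Qed.

(* The negative part of [y - u n] is dominated by [|y - u m|] for all [m >= n]. *)
Lemma ae_le01_cvg (u : nat -> X) y :
  (forall n m, (n <= m)%N -> ae_le01 (rep (u n)) (rep (u m))) ->
  u n @[n --> \oo] --> y -> forall n, ae_le01 (rep (u n)) (rep y).
Proof.
move=> u_nd uy n.
have [||z zE _] :=
  @inX_dominated (fun t => Num.min 0 (rep y t - rep (u n) t)) (y - u n).
- apply: measurable_minr; first exact: measurable_cst.
  by apply: measurable_funB; exact: kothe_measurable.
- apply: ae01S (repB y (u n)) => t _ ->.
  by rewrite /=; case: (ltgtP 0 (rep y t - rep (u n) t)) => h; rewrite ?normr0.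
suff z0 : z = 0.
  move: zE; rewrite z0; apply: ae01S2 rep0 => t _ ->.
  by case: (ltgtP 0 (rep y t - rep (u n) t)); lra.
apply/eqP; rewrite -normr_le0; apply/ler_addgt0Pr => e e0; rewrite add0r.
have : \forall m \near \oo, `|y - u m| < e by move/cvgrPdist_lt : uy; apply.
(* The index [maxn M n] is late enough both for the norm estimate and for monotonicity from
   [u n]. *)
move=> -[M _ uM]; have := uM (maxn M n) (leq_maxl _ _) => /= /ltW; apply: le_trans.
apply: kothe_le_norm.
apply: ae01S3 zE (repB y (u (maxn M n))) (u_nd _ _ (leq_maxr M n)) => t _ -> -> H3.
case: (ltgtP 0 (rep y t - rep (u n) t)) => h /=; rewrite ?normr0//.
by rewrite ltr0_norm// ler0_norm; lra.
Qed.

End Koethe.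

(** * Real-valued integrals on the unit interval *)

Section Integral01.
Context {R : realType}.
Notation mu := (@lebesgue_measure R).
Notation I := (unit_itv R).
Implicit Types f g : R -> R.

Lemma measurable_unit_itv : measurable I.
Proof. exact: measurable_itv. Qed.

Lemma integrable_measurable D f : mu.-integrable D (EFin \o f) ->
  measurable_fun D f.
Proof. by move=> /measurable_int fi; apply/measurable_EFinP. Qed.

Lemma ae_eq_Rintegral f g : measurable_fun I f -> measurable_fun I g ->
  ae_eq01 f g -> \int[mu]_(t in I) f t = \int[mu]_(t in I) g t.
Proof.
move=> mf mg fg; congr fine; apply: ae_eq_integral.
- exact: measurable_unit_itv.
- exact/measurable_EFinP.
- exact/measurable_EFinP.
- by apply: ae01S fg => t _ ->.
Qed.

Lemma ae_le_Rintegral f g : mu.-integrable I (EFin \o f) ->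
  mu.-integrable I (EFin \o g) -> ae_le01 f g ->
  \int[mu]_(t in I) f t <= \int[mu]_(t in I) g t.
Proof.
move=> fi gi fg; rewrite -subr_ge0 -RintegralB//.
have mfg : measurable_fun I (fun t => g t - f t).
  by apply: measurable_funB; exact: integrable_measurable.
rewrite (ae_eq_Rintegral mfg (g := fun t => `|g t - f t|)).
- by apply: Rintegral_ge0.
- exact: measurableT_comp.
- by apply: ae01S fg => t _ fg; rewrite ger0_norm// subr_ge0.
Qed.

Lemma Rintegral_indicM B f : B `<=` I ->
  \int[mu]_(t in I) (\1_B t * f t) = \int[mu]_(t in B) f t.
Proof.
move=> BI; rewrite -[in RHS](setIidr BI) Rintegral_mkcondr patch_indic.
by apply: eq_Rintegral => t _; rewrite mulrC.
Qed.

Lemma integrable_indicM B f : measurable B -> mu.-integrable I (EFin \o f) ->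
  mu.-integrable I (EFin \o (fun t => \1_B t * f t)).
Proof.
move=> mB fi; apply: (le_integrable _ _ _ fi) => //.
  apply/measurable_EFinP; apply: measurable_funM.
    exact: measurable_indic.
  exact: integrable_measurable fi.
move=> t _; rewrite /= lee_fin normrM ler_piMl// indicE.
by case: (_ \in _); rewrite ?normr1 ?normr0.
Qed.

Lemma EFin_Rintegral D f : measurable D -> mu.-integrable D (EFin \o f) ->
  (\int[mu]_(t in D) f t)%:E = (\int[mu]_(t in D) (f t)%:E)%E.
Proof. by move=> mD fi; rewrite fineK//; exact: integrable_fin_num. Qed.

Lemma dominated_Rintegral_cvg (u : nat -> R -> R) f g :
  (forall n, measurable_fun I (u n)) -> measurable_fun I f ->
  ae01 (fun t => u n t @[n --> \oo] --> f t) ->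
  mu.-integrable I (EFin \o g) -> ae01 (fun t => forall n, `|u n t| <= g t) ->
  \int[mu]_(t in I) u n t @[n --> \oo] --> \int[mu]_(t in I) f t.
Proof.
move=> mu_ mf uf gi ug.
have [||||fi _ cvgi] := @dominated_convergence _ _ R mu I measurable_unit_itv
    (fun n => EFin \o u n) (EFin \o f) (EFin \o g) _ _ _ gi.
- by move=> n; apply/measurable_EFinP; exact: mu_.
- exact/measurable_EFinP.
- by apply: ae01S uf => t _ uft; apply: cvg_EFin => //; exact: nearW.
- apply: (@filterS _ _ (ae_filter_ringOfSetsType mu) _ _ _ ug) => t h n It.
  by rewrite lee_fin; exact: h.
by apply: fine_cvg; rewrite EFin_Rintegral.
Qed.

End Integral01.

(** * Continuity of the inclusion into L1 *)

Section KoetheL1.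
Context {R : realType} {X : completeNormedModType R} {rep : X -> R -> R}.
Hypothesis K : is_kothe rep.
Notation mu := (@lebesgue_measure R).
Notation I := (unit_itv R).
Implicit Types (x y : X) (f g : R -> R).

Lemma kothe_abs x :
  exists z, ae_eq01 (rep z) (fun t => `|rep x t|) /\ `|z| <= `|x|.
Proof.
apply: (kothe_ideal K).
  by apply: measurableT_comp => //; exact: kothe_measurable.
by apply: ae01W => t _; rewrite normr_id.
Qed.

(* A norm-convergent series of positive elements with exploding integrals would
   be dominated by its sum, which is integrable. *)
Lemma kothe_L1_bounded :
  exists C, forall x, \int[mu]_(t in I) `|rep x t| <= C * `|x|.
Proof.
apply: contrapT => /forallNP noC.
have /choice[x xP] : forall n, exists x,
    4 ^+ n * `|x| < \int[mu]_(t in I) `|rep x t|.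
  move=> n; have /existsNP[x] := noC (4 ^+ n).
  by move=> /negP; rewrite -ltNge => ?; exists x.
have /choice[z zP] := fun n => kothe_abs (x n).
have zi n := kothe_integrable K (z n).
have zint n : \int[mu]_(t in I) rep (z n) t = \int[mu]_(t in I) `|rep (x n) t|.
  apply: ae_eq_Rintegral; [exact: kothe_measurable| |exact: (zP n).1].
  by apply: measurableT_comp => //; exact: kothe_measurable.
have x0 n : 0 < `|x n|.
  rewrite normr_gt0; apply/eqP => xn0; have := xP n; rewrite xn0 normr0 mulr0.
  rewrite (ae_eq_Rintegral (g := fun=> 0)).
  - by rewrite Rintegral_cst// mul0r ltxx.
  - by apply: measurableT_comp => //; exact: kothe_measurable.
  - exact: measurable_cst.
  - by apply: ae01S (rep0 K) => t _ ->; rewrite normr0.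
(* The factor [4 ^+ n] is shared out: after scaling by [a n] the norms are at most [2 ^- n], hence
   summable, while the integrals are still at least [2 ^+ n]. *)
pose a n := (2 ^+ n * `|x n|)^-1.
have a0 n : 0 < a n by rewrite invr_gt0 mulr_gt0// exprn_gt0.
pose y n := a n *: z n.
have y_le n : `|y n| <= (1 / 2) ^+ n.
  rewrite normrZ gtr0_norm// /a invfM -mulrA expr_div_n expr1n mul1r.
  rewrite -[leRHS]mulr1 ler_pM2l ?invr_gt0 ?exprn_gt0// mulrC ler_pdivrMr// mul1r.
  exact: (zP n).2.
have y_int n : 2 ^+ n <= \int[mu]_(t in I) rep (y n) t.
  rewrite (ae_eq_Rintegral (g := fun t => a n * rep (z n) t)).
  - rewrite RintegralZl// zint /a mulrC ler_pdivlMr ?mulr_gt0 ?exprn_gt0//.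
    by rewrite mulrA -exprMn -natrM; exact/ltW/xP.
  - exact: kothe_measurable.
  - by apply: measurable_funM => //; exact: kothe_measurable.
  - exact: repZ.
have y_ge0 : ae01 (fun t => forall n, 0 <= rep (y n) t).
  apply: ae01_forall => n; apply: ae01S2 (repZ K (a n) (z n)) (zP n).1 => t _ -> ->.
  by rewrite mulr_ge0// ltW.
have cvg_y : cvgn (series y).
  apply: normed_cvg.
  apply: (series_le_cvg _ _ y_le) => //.
  rewrite exprn_geometric; apply: is_cvg_geometric_series.
  by rewrite ger0_norm; lra.
have mono n m : (n <= m)%N -> ae_le01 (rep (series y n)) (rep (series y m)).
  move=> nm; apply: ae01S3 y_ge0 (rep_sum K y n) (rep_sum K y m) => t _ + -> ->.
  by move=> y0; rewrite [leRHS](big_cat_nat (leq0n n) nm)//= lerDl sumr_ge0.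
have le_lim := ae_le01_cvg K mono cvg_y.
have y_lim n : 2 ^+ n <= \int[mu]_(t in I) rep (limn (series y)) t.
  apply: (le_trans (y_int n)); apply: ae_le_Rintegral; try exact: kothe_integrable.
  apply: ae01S3 y_ge0 (rep_sum K y n.+1) (le_lim n.+1) => t _ y0 E; rewrite E.
  by apply: le_trans; rewrite big_nat_recr//= lerDr sumr_ge0.
(* The finite integral of the sum lies below some integer [N], hence below [2 ^+ N], contradicting
   [y_lim]. *)
have := Num.Theory.archi_boundP (le_trans (exprn_ge0 0 (ler0n R 2)) (y_lim 0%N)).
set N := Num.Def.archi_bound _ => /lt_le_trans /(_ (_ : _ <= 2 ^+ N)).
rewrite ltNge y_lim -natrX => H; apply/notF/H.
by rewrite ler_nat ltnW// ltn_expl.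
Qed.

End KoetheL1.

(** * Reflexivity and order continuity *)

Section Reflexive.
Context {R : realType} {X : completeNormedModType R} {rep : X -> R -> R}.
Hypothesis K : is_kothe rep.
Notation mu := (@lebesgue_measure R).
Notation I := (unit_itv R).
Implicit Types (x y : X) (f g : R -> R) (B : set R).

(** Boundedness comes from [kothe_L1_bounded]. These functionals separate vectors, which later
    identifies an element obtained from the bidual. *)
Lemma integral_topdual B : measurable B ->
  topdual X (fun x => \int[mu]_(t in I) (\1_B t * rep x t)).
Proof.
move=> mB.
have ii x := integrable_indicM mB (kothe_integrable K x).
have mm x := integrable_measurable (ii x).
have [C leC] := kothe_L1_bounded K; apply: (bounded_topdual (C := C)).
  move=> a x y; rewrite -[X in _ = X + _]/(a * \int[mu]_(t in I) (\1_B t * rep x t)).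
  rewrite -RintegralZl// -RintegralD//; last first.
    exact: integrableZl (ii x).
  apply: ae_eq_Rintegral; first exact: mm.
    apply: measurable_funD; last exact: mm.
    by apply: measurable_funM; [exact: measurable_cst|exact: mm].
  by apply: ae01S (kothe_linear K a x y) => t _ ->; rewrite mulrDr mulrCA.
move=> x; apply: le_trans (le_normr_Rintegral _ _) _ => //.
apply: le_trans (leC x); apply: ae_le_Rintegral.
- exact: (integrable_norm (ii x)).
- exact: (integrable_norm (kothe_integrable K x)).
- apply: ae01W => t _; rewrite normrM ler_piMl// indicE.
  by case: (_ \in _); rewrite ?normr1 ?normr0.
Qed.

(* With suitable signs [s i], the sum of the [|psi (u i - u i.+1)|] is the value of
   [psi] at the sum of the [s i *: (u i - u i.+1)], which is dominated by [u 0]. *)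
Lemma decreasing_topdual_cvg (u : nat -> X) (psi : X -> R^o) :
  ae01 (fun t => nonincreasing_seq (fun n => rep (u n) t)) ->
  ae01 (fun t => forall n, 0 <= rep (u n) t) ->
  topdual X psi -> cvgn (fun n => psi (u n)).
Proof.
move=> u_ni u_ge0 dpsi; have [f psiE] := topdual_linear dpsi.
pose v n := u n - u n.+1.
pose w n := Num.sg (psi (v n)) *: v n.
have vE : ae01 (fun t => forall n, rep (v n) t = rep (u n) t - rep (u n.+1) t).
  by apply: ae01_forall => n; exact: (repB K).
have wE : ae01 (fun t => forall n, rep (w n) t = Num.sg (psi (v n)) * rep (v n) t).
  by apply: ae01_forall => n; exact: (repZ K).
have le_w n : `|\sum_(0 <= i < n) w i| <= `|u 0%N|.
  apply: (kothe_le_norm K).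
  apply: ae01S2 (rep_sum K w n) (ae01S2 (fun t _ => @conj _ _) u_ni
    (ae01S3 (fun t _ a b c => conj a (conj b c)) u_ge0 vE wE)).
  move=> t _ -> [ut_ni [ut_ge0 [vtE wtE]]].
  apply: le_trans (ler_norm_sum _ _ _) _; rewrite ger0_norm//.
  apply: (@le_trans _ _ (\sum_(0 <= i < n) (rep (u i) t - rep (u i.+1) t))).
    apply: ler_sum => i _; rewrite wtE vtE normrM.
    rewrite [X in _ * X]ger0_norm ?subr_ge0; last exact: ut_ni.
    rewrite ler_piMl ?subr_ge0//; first exact: ut_ni.
    by rewrite normr_sg; case: (_ != _).
  rewrite (@telescope_sumr_eq _ _ _ (fun i => - rep (u i) t))//.
    by rewrite opprK addrC gerBl.
  by move=> k _; rewrite opprK addrC.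
have sumE n : psi (\sum_(0 <= i < n) w i) = \sum_(0 <= i < n) `|psi (v i)|.
  rewrite psiE linear_sum; apply: eq_bigr => i _.
  by rewrite /w psiE linearZ/= normrEsg.
have cvg_v : cvgn (series (fun n => psi (v n) : R^o)).
  apply: normed_cvg; apply: nondecreasing_is_cvgn.
    by apply/nondecreasing_series => i _ _; exact: normr_ge0.
  exists (dual_norm psi * `|u 0%N|) => _ [n _ <-].
  rewrite -[X in X <= _]sumE (le_trans (ler_norm _))//.
  rewrite (le_trans (le_dual_norm _ dpsi))//.
  by rewrite ler_wpM2l// dual_norm_ge0.
rewrite (_ : (fun n => _) =
  (fun n => psi (u 0%N) - series (fun n => psi (v n) : R^o) n)).
  by apply: is_cvgB => //; exact: is_cvg_cst.
apply/funext => n; rewrite /series/=.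
rewrite (@telescope_sumr_eq _ _ _ (fun i => - psi (u i)))//.
  by rewrite opprK opprD opprK addrCA subrr addr0.
by move=> k _; rewrite opprK /v psiE linearB/= addrC.
Qed.

Theorem reflexive_order_continuous : reflexive_space X -> order_continuous rep.
Proof.
move=> hX u hu.
have u_ni : ae01 (fun t => nonincreasing_seq (fun n => rep (u n) t)).
  by apply: ae01S hu => t _ [].
have u_ge0 : ae01 (fun t => forall n, 0 <= rep (u n) t).
  apply: ae01S hu => t _ [ni cv] n.
  by rewrite -(cvg_lim _ cv)//; apply: nonincreasing_cvgn_ge => //; exact: cvgP cv.
have nni : nonincreasing_seq (fun n => `|u n|).
  move=> n m nm; apply: (kothe_le_norm K); apply: ae01S2 u_ni u_ge0 => t _ ni ge0.
  by rewrite !ger0_norm//; exact: ni.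
split=> //; apply/cvgr0Pnorm_lt => /= e e0.
(* The norms decrease, so a single small one is enough. *)
have [[N uN]|noN] := pselect (exists N, `|u N| < e).
  exists N => // n /= Nn; rewrite normr_id; apply: le_lt_trans uN; exact: nni.
exfalso.
have le_u n : e <= `|u n|.
  by rewrite leNgt; apply/negP => ue; apply: noN; exists n.
(* The vectors lying above some [u n] form a set containing every [u n]; it is convex because the
   sequence decreases, and its elements have norm at least [e]. *)
pose C := [set y | exists n, ae_le01 (rep (u n)) (rep y)].
have [|||phi [phil phi1 phiC]] := @convex_separation _ X C e.
- by exists (u 0%N), 0%N; apply: ae01W.
- move=> a x y /andP[a0 a1] [n un] [m um]; exists (maxn n m).
  apply: ae01S3 un um (ae01S3 (fun t _ a b c => conj a (conj b c)) u_ni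
    (kothe_linear K a x ((1 - a) *: y)) (repZ K (1 - a) y)).
  move=> t _ xt yt [ni [-> ->]].
  have := ni _ _ (leq_maxl n m); have := ni _ _ (leq_maxr n m) => h1 h2.
  have : a * rep (u (maxn n m)) t <= a * rep x t.
    by rewrite ler_wpM2l// (le_trans h2).
  have : (1 - a) * rep (u (maxn n m)) t <= (1 - a) * rep y t.
    by rewrite ler_wpM2l ?subr_ge0// (le_trans h1).
  lra.
- move=> y [n un]; apply: le_trans (le_u n) _; apply: (kothe_le_norm K).
  apply: ae01S2 un u_ge0 => t _ h ge0; rewrite !ger0_norm//.
  exact: le_trans h.
have dphi : topdual X phi.
  by apply: (bounded_topdual (C := 1)) => // x; rewrite mul1r.
have cv psi : topdual X psi -> cvgn (fun n => psi (u n)).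
  exact: decreasing_topdual_cvg.
(* The limit along [u] is linear on the dual and bounded by the norm of [u 0], so reflexivity
   represents it by a vector [x]. *)
have [||x xP] := hX (fun psi => limn (fun n => psi (u n))).
- move=> a f g df dg; apply: cvg_lim => //.
  by apply: cvgD; [apply: cvgM; [exact: cvg_cst|]|]; exact: cv.
- exists `|u 0%N| => f df; rewrite mulrC -lim_norm; last exact: cv.
  apply: limr_le; first by apply: is_cvg_norm; exact: cv.
  near=> n; apply: le_trans (le_dual_norm _ df) _.
  by rewrite ler_wpM2l ?dual_norm_ge0//; exact: nni.
(* The integral of [rep x] over any measurable [B] is the limit of those of [rep (u n)], which is
   [0] by dominated convergence with bound [rep (u 0)]. *)
have x0 : x = 0.
  apply: (kothe_inj K); apply: ae_eq_trans (ae_eq_sym (rep0 K)).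
  have xi := kothe_integrable K x.
  suff : ae_eq mu I (EFin \o rep x) (cst 0%E) by apply: ae01S => t _ [].
  apply: integral_ae_eq => // B BI mB; rewrite integral0.
  have xBi : mu.-integrable B (EFin \o rep x) by apply: integrableS xi.
  rewrite -EFin_Rintegral// -Rintegral_indicM// -(xP _ (integral_topdual mB)).
  congr EFin; apply: cvg_lim => //.
  rewrite -[X in _ --> X](_ : \int[mu]_(t in I) 0 = 0); last first.
    by rewrite Rintegral_cst// mul0r.
  apply: (dominated_Rintegral_cvg (g := rep (u 0%N))) => //.
  - by move=> n; apply: measurable_funM => //; exact: kothe_measurable.
  - apply: ae01S hu => t _ [_ cvt]; rewrite -[X in _ --> X](mulr0 (\1_B t)).
    by apply: cvgM => //; exact: cvg_cst.
  - exact: kothe_integrable.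
  - apply: ae01S2 u_ni u_ge0 => t _ ni ge0 n.
    rewrite normrM (ger0_norm (ge0 n)) (le_trans _ (ni 0%N n _))//.
    by rewrite ler_piMl// indicE; case: (_ \in _); rewrite ?normr1 ?normr0.
(* The limit of [phi (u n)] is therefore [phi 0 = 0], although every term is at least [e]. *)
have := xP phi dphi; have [f phiE] := topdual_linear dphi.
rewrite x0 {2}phiE linear0 => h.
have : e <= limn (fun n => phi (u n)).
  apply: limr_ge; first exact: cv.
  by near=> n; apply: phiC; exists n; exact: ae01W.
by rewrite h leNgt e0.
Unshelve. all: by end_near. Qed.

End Reflexive.

(** * Integral representation of functionals *)

Section Representation.
Context {R : realType} {X : completeNormedModType R} {rep : X -> R -> R}.
Hypothesis K : is_kothe rep.
Hypothesis OC : order_continuous rep.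
Notation mu := (@lebesgue_measure R).
Notation I := (unit_itv R).
Implicit Types (x y : X) (f g : R -> R) (B : set R).

(** One choice of vectors for all measurable subsets of the line: [B] is first cut down to the unit
    interval, and nonmeasurable sets get [0]. *)
Lemma kothe_indicator :
  exists ind : set R -> X, forall B, measurable B -> ae_eq01 (rep (ind B)) \1_B.
Proof.
suff /choice[ind indP] : forall B, exists x, measurable B -> ae_eq01 (rep x) \1_B.
  by exists ind.
move=> B; have [mB|nB] := pselect (measurable B); last by exists 0.
have [x xB] : inX rep (\1_(I `&` B) : R -> R).
  apply: (kothe_indic K); first exact: measurableI.
  exact: subIsetl.
by exists x => _; apply: ae01S xB => t It ->; rewrite indicI /= indicE mem_set// mul1r.
Qed.

Variables (ind : set R -> X).
Hypothesis indP : forall B, measurable B -> ae_eq01 (rep (ind B)) \1_B.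

Lemma ind_eq0 B : measurable B -> ae_eq01 (\1_B : R -> R) (fun=> 0) -> ind B = 0.
Proof.
move=> mB B0; apply: (kothe_inj K).
by apply: ae01S3 (indP mB) B0 (rep0 K) => t _ -> -> ->.
Qed.

(** The remainders [r n] represent indicators of tails of the union; they decrease to [0] a.e.,
    hence in norm by order continuity, and [phi] is bounded. *)
Lemma ind_sigma_additive (phi : X -> R^o) (F : nat -> set R) :
  topdual X phi -> (forall n, measurable (F n)) -> trivIset setT F ->
  \sum_(0 <= i < n) phi (ind (F i)) @[n --> \oo] --> phi (ind (\bigcup_i F i)).
Proof.
move=> dphi mF tF; have mU : measurable (\bigcup_i F i) by exact: bigcup_measurable.
have [f phiE] := topdual_linear dphi.
pose r n := ind (\bigcup_i F i) - \sum_(0 <= i < n) ind (F i).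
have rE : ae01 (fun t => forall n,
    rep (r n) t = \1_(\bigcup_i F i) t - \sum_(0 <= i < n) \1_(F i) t).
  apply: ae01_forall => n.
  apply: ae01S2 (repB K (ind (\bigcup_i F i)) (\sum_(0 <= i < n) ind (F i)))
    (ae01S3 (fun t _ a b c => conj a (conj b c)) (indP mU)
      (rep_sum K (ind \o F) n) (ae01_forall (fun i => indP (mF i)))).
  move=> t _ -> [/= -> [-> iF]]; congr (_ - _).
  by apply: eq_bigr => i _; exact: iF.
have [_ r0] : nonincreasing_seq (fun n => `|r n|) /\ `|r n| @[n --> \oo] --> 0.
  apply: (OC (u := r)); apply: ae01S rE => t _ rtE; split.
    move=> n m nm; rewrite !rtE lerD2l lerN2.
    by rewrite [leRHS](big_cat_nat (leq0n n) nm)//= lerDl sumr_ge0.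
  rewrite (funext rtE) -[X in _ --> X](subrr (\1_(\bigcup_i F i) t)).
  apply: cvgB; first exact: cvg_cst.
  have : (\sum_(0 <= i < n) ((\1_(F i) t : R)%:E))%E @[n --> \oo] -->
         (\1_(\bigcup_i F i) t : R)%:E.
    rewrite indic_bigcup//; apply: is_cvg_nneseries => i _ _.
    by rewrite lee_fin.
  by under eq_fun do rewrite sumEFin; move=> /fine_cvg.
have [C C0 phiC] := topdual_bounded dphi.
have phir0 : phi (r n) @[n --> \oo] --> 0.
  apply: norm_cvg0; apply: (squeeze_cvgr (f := fun=> 0) (h := fun n => C * `|r n|)).
  - by apply: nearW => n; rewrite normr_ge0 phiC.
  - exact: cvg_cst.
  - by rewrite -(mulr0 C); apply: cvgM => //; exact: cvg_cst.
rewrite (_ : (fun n => _) = (fun n => phi (ind (\bigcup_i F i)) - phi (r n))).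
  rewrite -[X in _ --> X]subr0; apply: cvgB => //; exact: cvg_cst.
by apply/funext => n; rewrite /r phiE linearB/= linear_sum opprB addrC subrK.
Qed.

(** The set function [phi (ind B)] is a finite charge, absolutely continuous because [ind] sends
    null sets to [0]; [g] is its density. *)
Lemma radon_nikodym_functional (phi : X -> R^o) : topdual X phi ->
  exists g, mu.-integrable I (EFin \o g) /\
    forall B, measurable B -> B `<=` I -> phi (ind B) = \int[mu]_(t in B) g t.
Proof.
move=> dphi; have [f phiE] := topdual_linear dphi.
pose nu (B : set (measurableTypeR R)) : \bar R := (phi (ind B))%:E.
have nu0 : nu set0 = 0%E.
  rewrite /nu ind_eq0 ?phiE ?linear0//.
  by apply: ae01W => t _; rewrite indic0.
have nu_fin B : measurable B -> nu B \is a fin_num by [].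
have nu_sigma : semi_sigma_additive nu.
  move=> F mF tF mU; rewrite /nu.
  under eq_fun do rewrite sumEFin.
  by apply: cvg_EFin; [exact: nearW|exact: ind_sigma_additive].
pose Nu : {charge set (measurableTypeR R) -> \bar R} :=
  HB.pack nu (isCharge.Build _ _ _ nu nu0 nu_fin nu_sigma).
have NuMu : Nu `<< mu.
  apply/null_content_dominatesP => A mA A0.
  rewrite /Nu/= /nu ind_eq0 ?phiE ?linear0//.
  exists A; split => // t /=; rewrite indicE => /not_implyP[_].
  by case: (boolP (t \in A)) => [|_ /(_ erefl)//]; rewrite inE.
have RNi := Radon_Nikodym_integrable NuMu.
exists (fine \o Radon_Nikodym Nu mu).
have E : EFin \o (fine \o Radon_Nikodym Nu mu) = Radon_Nikodym Nu mu.
  by apply/funext => t /=; rewrite fineK//; exact: Radon_Nikodym_fin_num.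
split; first by rewrite E; apply: integrableS RNi.
move=> B mB BI; apply: EFin_inj; rewrite -[LHS]/(Nu B).
rewrite (Radon_Nikodym_integral NuMu)// EFin_Rintegral//.
  by apply: eq_integral => t _; rewrite -[RHS]/((EFin \o _) t) E.
by rewrite E; apply: integrableS RNi.
Qed.

(** * From indicators to all vectors of the space *)

Section Extension.
Variables (phi : X -> R^o) (g : R -> R).
Hypothesis dphi : topdual X phi.
Hypothesis gi : mu.-integrable I (EFin \o g).
Hypothesis gP : forall B, measurable B -> B `<=` I ->
  phi (ind B) = \int[mu]_(t in B) g t.

(** Integrability is recorded with the value: it is not known in advance for products with [g], and
    linearity of the real-valued integral requires it. *)
Definition pairs_with (f : R -> R) (x : X) :=
  [/\ ae_eq01 (rep x) f, mu.-integrable I (EFin \o (fun t => g t * f t))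
    & phi x = \int[mu]_(t in I) (g t * f t)].

Lemma pairs_with_indic B : measurable B -> exists x, pairs_with \1_B x.
Proof.
move=> mB; have mBI : measurable (B `&` I) by exact: measurableI.
have E t : I t -> \1_(B `&` I) t = \1_B t :> R.
  by move=> It; rewrite indicI /= [X in _ * X]indicE mem_set// mulr1.
exists (ind (B `&` I)); split.
- by apply: ae01S (indP mBI) => t It ->; exact: E.
- rewrite (_ : (fun t => _) = (fun t => \1_B t * g t)); last first.
    by apply/funext => t; rewrite mulrC.
  exact: integrable_indicM.
- rewrite (gP mBI (@subIsetr _ _ _)) -(Rintegral_indicM _ (@subIsetr _ _ _)).
  by apply: eq_Rintegral => t /set_mem It; rewrite E// mulrC.
Qed.

Lemma pairs_with_lin a f1 f2 x1 x2 : pairs_with f1 x1 -> pairs_with f2 x2 ->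
  pairs_with (fun t => a * f1 t + f2 t) (a *: x1 + x2).
Proof.
move=> [E1 i1 p1] [E2 i2 p2].
have ai : mu.-integrable I (EFin \o (fun t => a * (g t * f1 t))).
  exact: integrableZl i1.
have E : (fun t => g t * (a * f1 t + f2 t)) = (fun t => a * (g t * f1 t) + g t * f2 t).
  by apply/funext => t; rewrite mulrDr mulrCA.
split.
- by apply: ae01S3 (kothe_linear K a x1 x2) E1 E2 => t _ -> -> ->.
- by rewrite E; exact: integrableD ai i2.
- rewrite E RintegralD// RintegralZl//.
  by have [f phiE] := topdual_linear dphi; rewrite -p1 -p2 phiE linearP.
Qed.

Import HBNNSimple.

Lemma pairs_with_simple (s : {nnsfun R >-> R}) B : measurable B ->
  exists x, pairs_with (fun t => \1_B t * s t) x.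
Proof.
move=> mB.
(* A simple function is the finite sum of its values times indicators of their fibres; the proof is
   then an induction on the list of values. *)
have -> : (fun t => \1_B t * s t) = (fun t =>
    \sum_(y <- finmap.enum_fset (fset_set (range s))) y * \1_(B `&` s @^-1` [set y]) t).
  apply/funext => t; rewrite [s t]fimfunE fsbig_finite//= mulr_sumr.
  by apply: eq_bigr => y _; rewrite indicI/= mulrCA.
elim: (finmap.enum_fset _) => [|y r [x IH]].
  have [x xP] := pairs_with_indic measurable0.
  by exists x; under eq_fun do rewrite big_nil; move: xP; rewrite indic0.
have [|z zP] := @pairs_with_indic (B `&` s @^-1` [set y]).
  exact: measurableI.
exists (y *: z + x).
by under eq_fun do rewrite big_cons; exact: pairs_with_lin.
Qed.

(* On [B] the function [c g] is nonnegative, so monotone convergence along simple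
   functions gives integrability as well as the value of the integral. *)
Lemma pairs_with_constant_sign (c : R) f B x : measurable B -> measurable_fun setT f ->
  (forall t, 0 <= f t) -> c * c = 1 -> (forall t, B t -> 0 <= c * g t) ->
  ae_eq01 (rep x) f -> exists y, pairs_with (fun t => \1_B t * f t) y.
Proof.
move=> mB mf f0 cc gB xf.
have mfI : measurable_fun I f by exact: measurable_funTS.
have mEf : measurable_fun setT (EFin \o f) by apply/measurable_EFinP.
pose s := nnsfun_approx measurableT mEf.
have s_nd t : nondecreasing_seq (fun n => s n t).
  by move=> n m nm; exact/lefP/nd_nnsfun_approx.
have s_cvg t : s n t @[n --> \oo] --> f t.
  have Ef0 u : setT u -> (0 <= (EFin \o f) u)%E by rewrite lee_fin.
  by have /fine_cvg := cvg_nnsfun_approx measurableT mEf Ef0 (Logic.I : setT t).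
have s_ge0 n t : 0 <= s n t by [].
have ms n : measurable_fun I (s n) by exact: measurable_funTS.
have c0 : c != 0 by apply/eqP => c0; move: cc; rewrite c0 mul0r; lra.
have gm : measurable_fun I g by exact: integrable_measurable gi.
have [y yE _] : exists2 y, ae_eq01 (rep y) (fun t => \1_B t * f t) & `|y| <= `|x|.
  apply: (inX_dominated K); first by apply: measurable_funM.
  apply: ae01S xf => t _ ->; rewrite normrM ler_piMl// indicE.
  by case: (_ \in _); rewrite ?normr1 ?normr0.
have /choice[xs xsP] := fun n => pairs_with_simple (s n) mB.
(* [y - xs n] represents [\1_B] times [f - s n], which decreases to [0], so order continuity
   applies. *)
have phi_cvg : phi (xs n) @[n --> \oo] --> phi y.
  have [_ r0] : nonincreasing_seq (fun n => `|y - xs n|) /\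
                `|y - xs n| @[n --> \oo] --> 0.
    apply: (OC (u := fun n => y - xs n)).
    have : ae01 (fun t => forall n, rep (y - xs n) t = \1_B t * (f t - s n t)).
      apply: ae01_forall => n; have [xsE _ _] := xsP n.
      by apply: ae01S3 (repB K y (xs n)) yE xsE => t _ -> /= -> ->; rewrite mulrBr.
    apply: ae01S => t _ E; split.
      move=> n m nm; rewrite !E ler_wpM2l// lerD2l lerN2; exact: s_nd.
    rewrite (funext E) -[X in _ --> X](mulr0 (\1_B t)).
    apply: cvgM; first exact: cvg_cst.
    rewrite -[X in _ --> X](subrr (f t)).
    by apply: cvgB => //; exact: cvg_cst.
  have [C C0 phiC] := topdual_bounded dphi.
  have [h phiE] := topdual_linear dphi.
  apply/subr_cvg0; apply: norm_cvg0.
  apply: (squeeze_cvgr (f := fun=> 0) (h := fun n => C * `|y - xs n|)).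
  - apply: nearW => n; rewrite normr_ge0/=.
    by have := phiC (y - xs n); rewrite phiE linearB/= distrC.
  - exact: cvg_cst.
  - by rewrite -(mulr0 C); apply: cvgM => //; exact: cvg_cst.
pose G (u : R -> R) t := c * (g t * (\1_B t * u t)).
have mG u : measurable_fun I u -> measurable_fun I (G u).
  by move=> mu_; do 3 (apply: measurable_funM => //).
have G0 u t : 0 <= u t -> 0 <= G u t.
  move=> ut; rewrite /G indicE; case: (boolP (t \in B)) => [/set_mem Bt|_].
    by rewrite mul1r mulrA mulr_ge0// gB.
  by rewrite mul0r !mulr0.
have G_nd t : nondecreasing_seq (fun n => (G (s n) t)%:E).
  move=> n m nm; rewrite lee_fin /G indicE; case: (boolP (t \in B)) => [/set_mem Bt|_].
    by rewrite !mul1r !mulrA ler_wpM2l ?gB//; exact: s_nd.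
  by rewrite !mul0r !mulr0.
have G_lim t : limn (fun n => (G (s n) t)%:E) = (G f t)%:E.
  apply: cvg_lim => //; apply: cvg_EFin; first exact: nearW.
  by do 3 (apply: cvgM; first exact: cvg_cst).
have G_int n : (\int[mu]_(t in I) (G (s n) t)%:E)%E = (c * phi (xs n))%:E.
  have [_ si ->] := xsP n.
  rewrite -RintegralZl// EFin_Rintegral//.
  exact: integrableZl si.
(* The integrals of [G (s n)] tend to that of [G f] by monotone convergence and to [c * phi y] by
   [phi_cvg]; equating the limits also shows that the integral of [G f] is finite. *)
have Gf_int : (\int[mu]_(t in I) (G f t)%:E)%E = (c * phi y)%:E.
  have mGs n : measurable_fun I (fun t => (G (s n) t)%:E).
    by apply/measurable_EFinP; exact: mG.
  have Gs0 n t : I t -> (0 <= (G (s n) t)%:E)%E by rewrite lee_fin G0.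
  have H : (\int[mu]_(t in I) (G (s n) t)%:E)%E @[n --> \oo] -->
      (\int[mu]_(t in I) limn (fun n => (G (s n) t)%:E))%E.
    apply: (@cvg_monotone_convergence _ _ R mu I measurable_unit_itv).
    - exact: mGs.
    - exact: Gs0.
    - by move=> t _; exact: G_nd.
  have LE : (\int[mu]_(t in I) limn (fun n => (G (s n) t)%:E))%E =
            (\int[mu]_(t in I) (G f t)%:E)%E.
    by apply: eq_integral => t _; exact: G_lim.
  rewrite LE (funext G_int) in H.
  have H' : (c * phi (xs n))%:E @[n --> \oo] --> (c * phi y)%:E.
    apply: cvg_EFin; first exact: nearW.
    by apply: cvgM; [exact: cvg_cst|exact: phi_cvg].
  by rewrite -(cvg_lim (@ereal_hausdorff R) H') (cvg_lim (@ereal_hausdorff R) H).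
have Gfi : mu.-integrable I (EFin \o G f).
  apply/integrableP; split; first by apply/measurable_EFinP; exact: mG.
  under eq_integral do rewrite /= ger0_norm ?G0//.
  by rewrite Gf_int ltry.
have E : (fun t => g t * (\1_B t * f t)) = (fun t => c * G f t).
  by apply/funext => t; rewrite /G mulrA cc mul1r.
exists y; split => //; rewrite E; first exact: integrableZl Gfi.
rewrite RintegralZl//; apply: (mulfI c0); rewrite mulrA cc mul1r.
by apply: EFin_inj; rewrite -Gf_int EFin_Rintegral.
Qed.

(** The interval is split according to the sign of [g], with [c = 1] on one part and [c = -1] on the
    other. *)
Lemma pairs_with_nonneg f x : measurable_fun setT f -> (forall t, 0 <= f t) ->
  ae_eq01 (rep x) f -> exists y, pairs_with (fun t => \1_I t * f t) y.
Proof.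
move=> mf f0 xf.
have gm : measurable_fun I g by exact: integrable_measurable gi.
pose P := I `&` [set t | 0 <= g t]; pose N := I `\` P.
have mP : measurable P.
  by apply: measurable_fun_le => //; exact: measurable_cst.
have mN : measurable N by exact: measurableD.
have PN t : \1_I t = 1 * \1_P t + \1_N t :> R.
  rewrite mul1r !indicE in_setD /P in_setI.
  by case: (t \in I) => /=; rewrite ?addr0//; case: (_ \in _); rewrite ?addr0 ?add0r.
have [y1 y1P] : exists y, pairs_with (fun t => \1_P t * f t) y.
  apply: (pairs_with_constant_sign (c := 1)) xf => //; first by rewrite mulr1.
  by move=> t [_ gt]; rewrite mul1r.
have [y2 y2P] : exists y, pairs_with (fun t => \1_N t * f t) y.
  apply: (pairs_with_constant_sign (c := -1)) xf => //; first by rewrite mulrNN mulr1.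
  move=> t [It nP]; rewrite mulN1r oppr_ge0 leNgt; apply/negP => gt.
  by apply: nP; split => //; exact: ltW.
exists (1 *: y1 + y2); have := pairs_with_lin 1 y1P y2P.
by under eq_fun do rewrite mulrA -mulrDl -PN.
Qed.

Lemma pairs_with_rep x : pairs_with (rep x) x.
Proof.
(* Positive and negative parts, extended by [0] because [pairs_with_nonneg] asks for measurability
   and sign on the whole line. *)
pose p := (fun t => Num.max (rep x t) 0) \_ I.
pose n := (fun t => Num.max (- rep x t) 0) \_ I.
have mx := kothe_measurable K x.
have mp : measurable_fun setT p.
  have mq : measurable_fun I (rep x \max cst 0).
    by apply: measurable_maxr => //; exact: measurable_cst.
  exact: (measurable_restrictT _ measurable_unit_itv).1 mq.
have mn : measurable_fun setT n.
  have mq : measurable_fun I ((fun t => - rep x t) \max cst 0).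
    apply: measurable_maxr; last exact: measurable_cst.
    exact: measurableT_comp.
  exact: (measurable_restrictT _ measurable_unit_itv).1 mq.
have p0 t : 0 <= p t by rewrite /p patchE; case: ifP => // _; rewrite le_max lexx orbT.
have n0 t : 0 <= n t by rewrite /n patchE; case: ifP => // _; rewrite le_max lexx orbT.
have pnE t : I t -> p t - n t = rep x t.
  move=> It; rewrite /p /n !patchE mem_set//.
  by case: (leP 0 (rep x t)) => h; rewrite /Num.max; case: ltP; case: ltP; lra.
have dom (q : R -> R) : measurable_fun setT q ->
    (forall t, I t -> 0 <= q t <= `|rep x t|) ->
    exists y, ae_eq01 (rep y) q.
  move=> mq qx; have [||y yq _] := @inX_dominated _ _ _ K q x; last by exists y.
    exact: measurable_funTS.
  by apply: ae01W => t It; have /andP[q0 qle] := qx t It; rewrite ger0_norm.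
have [xp xpP] : exists y, ae_eq01 (rep y) p.
  apply: dom => // t It; rewrite p0 /p patchE mem_set//.
  by rewrite ge_max ler_norm normr_ge0.
have [xn xnP] : exists y, ae_eq01 (rep y) n.
  apply: dom => // t It; rewrite n0 /n patchE mem_set//.
  by rewrite ge_max -normrN ler_norm normr_ge0.
have [yp ypP] := pairs_with_nonneg mp p0 xpP.
have [yn ynP] := pairs_with_nonneg mn n0 xnP.
have [zE zi zphi] := pairs_with_lin (-1) ynP ypP.
have E t : I t -> -1 * (\1_I t * n t) + \1_I t * p t = rep x t.
  by move=> It; rewrite indicE mem_set// !mul1r mulN1r addrC pnE.
have zx : -1 *: yn + yp = x.
  apply: (kothe_inj K); apply: ae01S zE => t It ->; exact: E.
split; first exact: ae_eq_refl.
- apply: eq_integrable zi => // t /set_mem It; rewrite /= E//.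
- rewrite -zx zphi; apply: eq_Rintegral => t /set_mem It; rewrite zx E//.
Qed.

End Extension.

End Representation.

Theorem kothe_functional_pairing (R : realType) (X : completeNormedModType R)
    (rep : X -> R -> R) (phi : X -> R^o) :
  is_kothe rep -> order_continuous rep -> topdual X phi ->
  exists g : R -> R, measurable_fun (unit_itv R) g /\ forall x,
    lebesgue_measure.-integrable (unit_itv R) (EFin \o (fun t => g t * rep x t)) /\
    phi x = \int[lebesgue_measure]_(t in unit_itv R) (g t * rep x t).
Proof.
move=> K OC dphi; have [ind indP] := kothe_indicator K.
have [g [gi gP]] := radon_nikodym_functional K OC indP dphi.
exists g; split; first exact: integrable_measurable gi.
by move=> x; have [_ ? ?] := pairs_with_rep K OC indP dphi gi gP x.
Qed.

(** * Balancing signs *)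

Section Lebesgue01.
Context {R : realType}.
Notation mu := (@lebesgue_measure R).
Notation I := (unit_itv R).
Implicit Types A B D : set R.

Definition len A : R := fine (mu A).

Lemma mu_unit_itv : mu I = 1%E.
Proof. by rewrite lebesgue_measure_itv/= lte01 sube0. Qed.

Lemma lenE A : measurable A -> A `<=` I -> (len A)%:E = mu A.
Proof.
move=> mA AI; rewrite fineK// ge0_fin_numE//.
apply: (@le_lt_trans _ _ (mu I)); last by rewrite mu_unit_itv ltry.
by apply: le_measure; rewrite ?inE.
Qed.

Lemma len_ge0 A : 0 <= len A.
Proof. exact: fine_ge0. Qed.

Lemma len0 : len set0 = 0.
Proof. by rewrite -[RHS]/(fine 0%E); congr fine; exact: measure0. Qed.

Lemma len_indic A : measurable A -> A `<=` I ->
  \int[mu]_(t in I) (\1_A t : R) = len A.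
Proof. by move=> mA AI; rewrite /Rintegral integral_indic// setIidl. Qed.

Lemma le_len A B : measurable A -> measurable B -> A `<=` B -> B `<=` I ->
  len A <= len B.
Proof.
move=> mA mB AB BI; rewrite -lee_fin !lenE//; last exact: subset_trans BI.
by rewrite le_measure ?inE.
Qed.

Lemma lenU A B : measurable A -> measurable B -> A `<=` I -> B `<=` I ->
  A `&` B = set0 -> len (A `|` B) = len A + len B.
Proof.
move=> mA mB AI BI AB; apply: EFin_inj; rewrite EFinD !lenE//.
- exact: measureU.
- exact: measurableU.
- by move=> t [/AI|/BI].
Qed.

Lemma integrable_indic01 A : measurable A -> A `<=` I ->
  mu.-integrable I (EFin \o (\1_A : R -> R)).
Proof.
move=> mA AI; apply/integrableP; split; first by apply/measurable_EFinP.
under eq_integral do rewrite /= ger0_norm//.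
by rewrite integral_indic// setIidl//; have := ltry (len A); rewrite lenE.
Qed.

(** The measure of the part of [D] in [[0, x]] is continuous in [x] and runs from [0] to [len D], so
    the intermediate value theorem applies. *)
Lemma len_subset D c : measurable D -> D `<=` I -> 0 <= c <= len D ->
  exists B, [/\ measurable B, B `<=` D & len B = c].
Proof.
move=> mD DI /andP[c0 cD].
have Di : mu.-integrable I (EFin \o \1_D).
  exact: integrable_indic01.
have := parameterized_integral_continuous ler01 Di.
move=> Fc; pose F x := parameterized_integral mu 0 x \1_D.
have FE x : F x = len (D `&` `[0, x]).
  by rewrite /F /parameterized_integral /Rintegral integral_indic.
have F0 : F 0 = 0.
  have m0 : measurable (D `&` `[0, 0]) by exact: measurableI.
  apply/eqP; rewrite FE eq_le len_ge0 andbT -lee_fin lenE//; last first.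
    by apply: subset_trans DI; exact: subIsetl.
  rewrite -[leRHS]/(0%E : \bar R) -(lebesgue_measure_set1 (0 : R)).
  apply: le_measure; rewrite ?inE//.
  by move=> u [_ /=]; rewrite itvxx => /eqP.
have F1 : F 1 = len D by rewrite FE setIidl.
have [|t _ Ft] := IVT (v := c) ler01 Fc.
  rewrite -[parameterized_integral _ _ _ _]/(F 0) -[X in Num.max _ X]/(F 1).
  by rewrite F0 F1 le_max ge_min c0 cD orbT.
exists (D `&` `[0, t]); split; [|exact: subIsetl|by rewrite -FE].
exact: measurableI.
Qed.

End Lebesgue01.

(** * Signs on measurable sets and their imbalance *)

Section Signs.
Context {R : realType} {X : completeNormedModType R} {rep : X -> R -> R}.
Hypothesis K : is_kothe rep.
Variable ind : set R -> X.
Hypothesis indP : forall B, measurable B -> ae_eq01 (rep (ind B)) \1_B.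
Notation mu := (@lebesgue_measure R).
Notation I := (unit_itv R).
Implicit Types A B C D P N : set R.

Lemma indU A B : measurable A -> measurable B -> A `&` B = set0 ->
  ind (A `|` B) = ind A + ind B.
Proof.
move=> mA mB AB; apply: (kothe_inj K).
apply: ae01S3 (indP (measurableU _ _ mA mB)) (repD K (ind A) (ind B))
  (ae01S2 (fun t _ => @conj _ _) (indP mA) (indP mB)) => t _ -> -> [/= -> ->].
rewrite !indicE in_setU; case: (boolP (t \in A)) => [/set_mem At|_ /=]; last first.
  by rewrite add0r.
case: (boolP (t \in B)) => [/set_mem Bt|_]; last by rewrite addr0.
by exfalso; rewrite -[False]/(set0 t) -AB.
Qed.

(** Halving the measure repeatedly gives a decreasing sequence of sets of positive measure with null
    intersection; order continuity sends the norms of their indicators to [0]. *)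
Lemma small_subset A (e : R) : order_continuous rep ->
  measurable A -> A `<=` I -> 0 < len A -> 0 < e ->
  exists D, [/\ measurable D, D `<=` A, 0 < len D & `|ind D| < e].
Proof.
move=> OC mA AI A0 e0.
have /choice[half halfP] : forall D, exists B, measurable D -> D `<=` I ->
    [/\ measurable B, B `<=` D & len B = len D / 2].
  move=> D; have [[mD DI]|nD] := pselect (measurable D /\ D `<=` I); last first.
    by exists set0 => mD DI; exfalso; apply: nD.
  have [|B BP] := @len_subset _ D (len D / 2) mD DI; last by exists B.
  by have := len_ge0 D => h; apply/andP; split; lra.
pose D n := iter n half A.
have DP n : [/\ measurable (D n), D n `<=` A & len (D n) = len A / 2 ^+ n].
  elim: n => [|n [mD DA lD]]; first by split=> //; rewrite expr0 divr1.
  have [mB BD lB] := halfP _ mD (subset_trans DA AI).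
  split=> //; first exact: subset_trans BD DA.
  by rewrite [LHS]lB lD exprSr invfM mulrA.
have mD n : measurable (D n) by have [] := DP n.
have DS n : D n.+1 `<=` D n.
  by have [mDn DA _] := DP n; have [] := halfP _ mDn (subset_trans DA AI).
have DI n : D n `<=` I by have [_ DA _] := DP n; exact: subset_trans AI.
have D_ni n m : (n <= m)%N -> D m `<=` D n.
  by move=> /subnKC <-; elim: (m - n)%N => [|k IH]; rewrite ?addn0// addnS;
    exact: subset_trans IH.
(* For each [d > 0], any [N > len A / d] gives [len (D N) = len A / 2 ^+ N <= d]. *)
have null : \forall t \ae mu, I t -> exists n, ~ D n t.
  have mN : measurable (\bigcap_n D n) by exact: bigcap_measurable.
  have NI : \bigcap_n D n `<=` I by move=> t /(_ 0%N Logic.I); exact: DI.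
  exists (\bigcap_n D n); split => //.
    rewrite -lenE//; congr EFin; apply/eqP; rewrite eq_le len_ge0 andbT.
    apply/ler_addgt0Pr => d d0; rewrite add0r.
    have := archi_boundP (divr_ge0 (ltW A0) (ltW d0)).
    set N := Num.Def.archi_bound _; rewrite ltr_pdivrMr// => /ltW AN.
    have [mDN _ lD] := DP N.
    apply: (@le_trans _ _ (len (D N))); first by apply: le_len => // t; exact.
    rewrite lD ler_pdivrMr ?exprn_gt0// (le_trans AN)// mulrC ler_wpM2l ?ltW//.
    by rewrite -natrX ltr_nat ltn_expl.
  move=> t /= /not_implyP[It /forallNP nD] n _; apply: contrapT; exact: nD.
have [_ cvgD] : nonincreasing_seq (fun n => `|ind (D n)|) /\
                `|ind (D n)| @[n --> \oo] --> 0.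
  apply: (OC (ind \o D)).
  apply: ae01S2 null (ae01_forall (fun n => indP (mD n))) => t _ [N nDN] E; split.
    move=> n m nm; rewrite /= !E !indicE.
    case: (boolP (t \in D m)) => [/set_mem Dm|_]; last by rewrite ler0n.
    by rewrite mem_set//; exact: D_ni nm _ Dm.
  apply: cvg_near_cst; exists N => // n /= Nn; rewrite E indicE memNset//.
  by move=> Dn; apply: nDN; exact: D_ni Nn _ Dn.
have [N _ Nsmall] : \forall n \near \oo, `|ind (D n)| < e.
  by move/cvgr0Pnorm_lt : cvgD => /(_ _ e0); apply: filterS => n; rewrite normr_id.
exists (D N); have [_ DA lD] := DP N; split => //; last exact: Nsmall N (leqnn N).
by rewrite lD divr_gt0// exprn_gt0.
Qed.

(* [x] is a sign supported by [A], with mean [c]. *)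
Definition signed_indicator A x (c : R) :=
  exists P N, [/\ measurable P, measurable N, P `&` N = set0, A = P `|` N
    & x = ind P - ind N /\ c = len P - len N].

Lemma signed_indicatorN A x c :
  signed_indicator A x c -> signed_indicator A (- x) (- c).
Proof.
move=> [P [N [mP mN PN -> [-> ->]]]]; exists N, P; split => //.
- by rewrite setIC.
- by rewrite setUC.
- by rewrite !opprB.
Qed.

Lemma signed_indicatorD A B x y c d : A `<=` I -> B `<=` I -> A `&` B = set0 ->
  signed_indicator A x c -> signed_indicator B y d ->
  signed_indicator (A `|` B) (x + y) (c + d).
Proof.
move=> + + + [P [N [mP mN PN AE [-> ->]]]] [P' [N' [mP' mN' PN' BE [-> ->]]]].
rewrite {}AE {}BE => PNI PNI' AB.
have dis t : (P `|` N) t -> (P' `|` N') t -> False.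
  by move=> ? ?; rewrite -[False]/(set0 t) -AB.
have [PI NI] : P `<=` I /\ N `<=` I.
  by split=> t ?; apply: PNI; [left|right].
have [PI' NI'] : P' `<=` I /\ N' `<=` I.
  by split=> t ?; apply: PNI'; [left|right].
have disj Q Q' : Q `<=` P `|` N -> Q' `<=` P' `|` N' -> Q `&` Q' = set0.
  by move=> QPN QPN'; rewrite -subset0 => t [/QPN ? /QPN' ?]; exact: (dis t).
have PP' : P `&` P' = set0 by apply: disj; exact: subsetUl.
have NN' : N `&` N' = set0 by apply: disj; exact: subsetUr.
have PN'0 : P `&` N' = set0 by apply: disj; [exact: subsetUl|exact: subsetUr].
have P'N0 : N `&` P' = set0 by apply: disj; [exact: subsetUr|exact: subsetUl].
exists (P `|` P'), (N `|` N'); split.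
- exact: measurableU.
- exact: measurableU.
- by rewrite setIUl !setIUr PN PN'0 PN' setIC P'N0 !setU0.
- by rewrite setUACA.
- by rewrite !indU// !lenU// !opprD; split; rewrite addrACA.
Qed.

Lemma signed_indicator_le A x c : A `<=` I -> signed_indicator A x c -> `|c| <= len A.
Proof.
move=> PNI [P [N [mP mN PN AE [_ ->]]]]; rewrite {}AE in PNI *; rewrite lenU//.
- have := len_ge0 P; have := len_ge0 N; rewrite ler_norml => *.
  by apply/andP; split; lra.
- by apply: subset_trans PNI; exact: subsetUl.
- by apply: subset_trans PNI; exact: subsetUr.
Qed.

(** Greedy orientation: a piece of measure at most [h] changes the imbalance by at most [h] in
    absolute value, and reversing its sign when needed keeps the total within [[-h, h]]. *)
Lemma nearly_balanced_sign (T : {linear X -> X}) A (h e : R) :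
  (forall B d, measurable B -> B `<=` I -> 0 < d ->
    exists x c, signed_indicator B x c /\ `|T x| <= d) ->
  measurable A -> A `<=` I -> 0 < h -> 0 < e ->
  exists x c, [/\ signed_indicator A x c, `|T x| <= e & `|c| <= h].
Proof.
move=> Tsmall mA AI h0 e0.
have := archi_boundP (ltW (divr_gt0 ltr01 h0)).
set m := Num.Def.archi_bound _; rewrite ltr_pdivrMr// => mh.
have m0 : (0 : R) < m%:R by rewrite -(pmulr_lgt0 _ h0); apply: lt_trans mh.
(* As [m%:R * h > 1], the set [B m] is all of [A], and [m] slices of width [h] suffice. The open
   right end makes [B 0] empty, which starts the induction. *)
pose B k := A `&` `]-oo, k%:R * h[.
have BI k : B k `<=` I by apply: subset_trans AI; exact: subIsetl.
have mB k : measurable (B k) by exact: measurableI.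
have [x [c [xc Tx ch]]] : exists x c,
    [/\ signed_indicator (B m) x c, `|T x| <= m%:R * (e / m%:R) & `|c| <= h].
  (* Only the number of slices varies; the budget [e / m%:R] per slice stays fixed. *)
  elim: {1 2}m => [|k [x [c [xc Tx ch]]]].
    exists 0, 0; rewrite linear0 !normr0 mul0r; split; [|by []|exact: ltW].
    exists set0, set0; split => //; last by rewrite !subrr.
      by rewrite setI0.
    rewrite setU0 -subset0 => t [/AI/= + /=].
    by rewrite !in_itv/= mul0r => /andP[]; case: ltgtP.
  pose C := A `&` `[k%:R * h, k.+1%:R * h[.
  have CI : C `<=` I by apply: subset_trans AI; exact: subIsetl.
  have mC : measurable C by exact: measurableI.
  have BC : B k.+1 = B k `|` C.
    rewrite /B /C -setIUr; congr (_ `&` _); apply/seteqP; split => t /=.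
      rewrite !in_itv/= => tk; have [?|?] := ltP t (k%:R * h); [by left|right].
      by apply/andP.
    rewrite !in_itv/= => -[tk|/andP[]//]; apply: lt_le_trans tk _.
    by rewrite ler_wpM2r ?ler_nat// ltW.
  have BC0 : B k `&` C = set0.
    rewrite -subset0 => t [[_ /=] + [_ /=]]; rewrite !in_itv/= => tk /andP[].
    by rewrite leNgt tk.
  have lenC : len C <= h.
    rewrite -lee_fin lenE//; apply: (@le_trans _ _ (mu `[k%:R * h, k.+1%:R * h[)).
      by apply: le_measure; rewrite ?inE//; exact: subIsetr.
    rewrite lebesgue_measure_itv/= lte_fin; case: ifP => _.
      by rewrite -EFinB lee_fin -mulrBl -natr1 addrAC subrr add0r mul1r.
    by rewrite lee_fin ltW.
  have [y [d [yd Ty]]] := Tsmall C (e / m%:R) mC CI (divr_gt0 e0 m0).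
  have dh := le_trans (signed_indicator_le CI yd) lenC.
  (* Opposite signs of [c] and [d] favour the sum, equal signs the difference. *)
  have [cd|cd] : `|c + d| <= h \/ `|c - d| <= h.
    move: ch dh; rewrite !ler_norml => /andP[? ?] /andP[? ?].
    have [?|?] := leP 0 c; have [?|?] := leP 0 d;
      (by left; apply/andP; split; lra) || (by right; apply/andP; split; lra).
  - exists (x + y), (c + d); split => //.
      by rewrite BC; exact: signed_indicatorD.
    rewrite linearD -addn1 natrD mulrDl mul1r (le_trans (ler_normD _ _))//.
    exact: lerD.
  - exists (x - y), (c - d); split => //.
      by rewrite BC; apply: signed_indicatorD => //; exact: signed_indicatorN.
    rewrite linearB -addn1 natrD mulrDl mul1r (le_trans (ler_normB _ _))//.
    exact: lerD.
exists x, c; split => //; last by rewrite mulrCA divff ?mulr1 ?gt_eqF in Tx.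
rewrite (_ : A = B m)//; apply/esym/setIidl => t /AI/=.
rewrite !in_itv/= => /andP[_ t1].
exact: le_lt_trans t1 mh.
Qed.

Lemma signed_indicator_rep A x c : A `<=` I -> signed_indicator A x c ->
  ae_eq01 (fun t => rep x t ^+ 2) \1_A /\ \int[mu]_(t in I) rep x t = c.
Proof.
move=> AI [P [N [mP mN PN AE [-> ->]]]]; rewrite {}AE in AI *.
have PI : P `<=` I by apply: subset_trans AI; exact: subsetUl.
have NI : N `<=` I by apply: subset_trans AI; exact: subsetUr.
have E : ae_eq01 (rep (ind P - ind N)) (fun t => \1_P t - \1_N t).
  by apply: ae01S3 (repB K (ind P) (ind N)) (indP mP) (indP mN) => t _ -> /= -> ->.
split.
  apply: ae01S E => t _ ->; rewrite !indicE in_setU.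
  case: (boolP (t \in P)) => [/set_mem Pt|_]; last first.
    by case: (t \in N); rewrite ?subr0 ?sub0r ?sqrrN ?expr1n ?expr0n.
  case: (boolP (t \in N)) => [/set_mem Nt|_]; last by rewrite subr0 expr1n.
  by exfalso; rewrite -[False]/(set0 t) -PN.
rewrite (ae_eq_Rintegral _ _ E); [|exact: kothe_measurable|exact: measurable_funB].
by rewrite RintegralB ?len_indic//; exact: integrable_indic01.
Qed.

Lemma balanced_sign (T : {linear X -> X}) (C : R) A (e : R) :
  order_continuous rep -> 0 < C -> (forall x, `|T x| <= C * `|x|) ->
  (forall B d, measurable B -> B `<=` I -> 0 < d ->
    exists x c, signed_indicator B x c /\ `|T x| <= d) ->
  measurable A -> A `<=` I -> 0 < e ->
  exists x, signed_indicator A x 0 /\ `|T x| < e.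
Proof.
move=> OC C0 TC Tsmall mA AI e0.
(* On a null set every sign is the zero vector. *)
have [A0|A0] := leP (len A) 0.
  exists (ind A); split.
    exists A, set0; split => //; [by rewrite setI0|by rewrite setU0|].
    have lA : len A = 0 by apply/eqP; rewrite eq_le A0 len_ge0.
    rewrite lA len0 subr0 (ind_eq0 K indP measurable0) ?subr0//.
    by apply: ae01W => t _; rewrite indic0.
  rewrite (ind_eq0 K indP mA) ?linear0 ?normr0//.
  exists A; split => //.
    by rewrite -lenE//; congr EFin; apply/eqP; rewrite eq_le A0 len_ge0.
  move=> t /= /not_implyP[_]; rewrite indicE.
  by case: (boolP (t \in A)) => [/set_mem//|_ []].
(* The bound on [ind D] makes the image of any sign on [D] smaller than [e / 2]; the rest of [A] is
   allowed [e / 4]. *)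
have [|D [mD DA D0 indD]] := @small_subset A (e / (2 * C)) OC mA AI A0.
  by rewrite divr_gt0// mulr_gt0.
have DI : D `<=` I by exact: subset_trans AI.
have mAD : measurable (A `\` D) by exact: measurableD.
have ADI : A `\` D `<=` I by apply: subset_trans AI; exact: subDsetl.
have [|x [c [xc Tx cD]]] :=
    @nearly_balanced_sign T (A `\` D) (len D) (e / 4) Tsmall mAD ADI D0.
  by rewrite divr_gt0.
move: cD; rewrite ler_norml => /andP[cD1 cD2].
(* With this measure the sign equal to [1] on [B] and [-1] on the rest of [D] has mean
   [2 * len B - len D = - c]. The value is admissible because the absolute value of [c] is at most
   [len D]. *)
have [|B [mB BD lB]] := @len_subset _ D ((len D - c) / 2) mD DI.
  by apply/andP; split; lra.
have mDB : measurable (D `\` B) by exact: measurableD.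
have BDB : B `&` (D `\` B) = set0 by rewrite setDIK.
have DE : D = B `|` (D `\` B) by rewrite setDUK.
have lDB : len (D `\` B) = len D - len B.
  rewrite [in RHS]DE lenU//; first by rewrite addrC addKr.
    exact: subset_trans DI.
  by apply: subset_trans DI; exact: subDsetl.
pose y := ind B - ind (D `\` B).
have yD : signed_indicator D y (- c).
  by exists B, (D `\` B); split => //; split => //; rewrite lDB lB; lra.
exists (x + y); split.
  rewrite -(subrr c) (_ : A = (A `\` D) `|` D); last by rewrite setUC setDUK.
  apply: signed_indicatorD => //.
  by rewrite setIC setDIK.
have y_le : `|y| <= `|ind D|.
  apply: (kothe_le_norm K).
  have [E _] := signed_indicator_rep DI yD.
  apply: ae01S2 E (indP mD) => t _ E ->; rewrite -(ler_pXn2r (ltn0Sn 1)) ?nnegrE//.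
  rewrite real_normK ?num_real// E indicE.
  by case: (t \in D); rewrite ?normr1 ?normr0 ?expr1n// expr0n.
rewrite linearD (le_lt_trans (ler_normD _ _))//.
have : C * `|ind D| < e / 2.
  by rewrite mulrC -ltr_pdivlMr// -mulrA -invfM.
have := TC y; have : C * `|y| <= C * `|ind D| by rewrite ler_wpM2l// ltW.
by lra.
Qed.

End Signs.

(** * Signs and functionals in a rearrangement-invariant space *)

Section Pairing.
Context {R : realType} {E : riSpace R}.
Notation mu := (@lebesgue_measure R).
Notation I := (unit_itv R).
Implicit Types (B A P N : set R).
Let K : is_kothe (@ri_fun R E) := ri_kothe (ri_spaceP E).
Variable ind : set R -> E.
Hypothesis indP : forall B, measurable B -> ae_eq01 (ri_fun (ind B)) \1_B.

Lemma pairing_repr_indic (phi : E -> R^o) g B : measurable B -> B `<=` I ->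
  pairing_repr phi g -> phi (ind B) = \int[mu]_(t in B) g t.
Proof.
move=> mB BI [mg gP]; have [_ ->] := gP (ind B).
rewrite -(Rintegral_indicM _ BI); apply: ae_eq_Rintegral.
- by apply: measurable_funM => //; exact: kothe_measurable.
- exact: measurable_funM.
- by apply: ae01S (indP mB) => t _ ->; rewrite mulrC.
Qed.

(** A.e. on the interval, [x] is [1] or [-1] on [A] and [0] off it, so the part of [A] where [x] is
    nonnegative is, up to a null set, where it equals [1]. *)
Lemma sign_decomposition A (x : E) : measurable A -> A `<=` I ->
  ae_eq01 (fun t => ri_fun x t ^+ 2) \1_A ->
  exists P N, [/\ measurable P, measurable N, P `&` N = set0, A = P `|` N
    & x = ind P - ind N].
Proof.
move=> mA AI x2; pose P := A `&` (I `&` [set t | 0 <= ri_fun x t]).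
have mP : measurable P.
  apply: measurableI => //; apply: measurable_fun_le => //.
  exact: kothe_measurable.
have mN : measurable (A `\` P) by exact: measurableD.
exists P, (A `\` P); split => //.
- exact: setDIK.
- by rewrite setDUK//; exact: subIsetl.
apply: (kothe_inj K).
apply: ae01S3 x2 (repB K (ind P) (ind (A `\` P)))
  (ae01S2 (fun t _ => @conj _ _) (indP mP) (indP mN)) => t It x2 -> [/= -> ->].
move: x2; rewrite !indicE in_setD /P !in_setI (mem_set It)/=.
case: (t \in A) => /= [/eqP|/eqP]; last by rewrite sqrf_eq0 subr0 => /eqP.
rewrite sqrf_eq1; case: (boolP (t \in _)) => [/set_mem/= x0|/negP x0] /orP[]/eqP xE.
- by rewrite xE subr0.
- by move: x0; rewrite xE; lra.
- by exfalso; apply: x0; rewrite inE/= xE.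
- by rewrite xE sub0r.
Qed.

End Pairing.

Theorem proposition5p5 (R : realType) (E : riSpace R) (T : {linear E -> E})
    (hE : reflexive_space E) (hT : bounded_near T (nbhs (0 : E))) :
  narrow T <-> poor (as_functions (adjoint T @` dual_ball E)).
Proof.
have K : is_kothe (@ri_fun R E) := ri_kothe (ri_spaceP E).
have OC := reflexive_order_continuous K hE.
have [ind indP] := kothe_indicator K.
have [C C0 TC] : exists2 C, 0 < C & forall x, `|T x| <= C * `|x|.
  by have /linear_boundedP/pinfty_ex_gt0[C C0 TC] := hT; exists C.
split=> [narT A e mA AI e0|poorT A e mA AI e0].
  have [x [x2 x0 Tx]] := narT A e mA AI e0.
  have [P [N [mP mN PN AE xE]]] := sign_decomposition indP mA AI x2.
  have PI : P `<=` unit_itv R by apply: subset_trans AI; rewrite AE; exact: subsetUl.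
  have NI : N `<=` unit_itv R by apply: subset_trans AI; rewrite AE; exact: subsetUr.
  exists P, N; split => // g [_ [psi [dpsi psi1] <-] gP].
  rewrite -(pairing_repr_indic indP mP PI gP) -(pairing_repr_indic indP mN NI gP).
  have [f psiE] := topdual_linear dpsi.
  (* The two integrals of [g] have become values of the adjoint functional, so the estimate is
     uniform over the dual ball. *)
  have -> : adjoint T psi (ind P) - adjoint T psi (ind N) = psi (T x).
    by rewrite /adjoint/= xE psiE !linearB.
  apply: le_lt_trans Tx; apply: le_trans (le_dual_norm _ dpsi) _.
  by rewrite ler_piMl.
have Tsmall B d : measurable B -> B `<=` unit_itv R -> 0 < d ->
    exists x c, signed_indicator ind B x c /\ `|T x| <= d.
  move=> mB BI d0; have [P [N [mP mN PN BE small]]] := poorT B d mB BI d0.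
  have PI : P `<=` unit_itv R by apply: subset_trans BI; rewrite BE; exact: subsetUl.
  have NI : N `<=` unit_itv R by apply: subset_trans BI; rewrite BE; exact: subsetUr.
  exists (ind P - ind N), (len P - len N); split; first by exists P, N.
  set x := ind P - ind N.
  (* A functional in the dual ball that norms [T x]. *)
  have [|||psi [psil psi1 psiC]] := @convex_separation _ E [set T x] `|T x|.
  - by exists (T x).
  - by move=> a u v _ -> ->; rewrite -scalerDl addrCA subrr addr0 scale1r.
  - by move=> _ ->.
  have dpsi : topdual E psi.
    by apply: (bounded_topdual (C := 1)) => // y; rewrite mul1r.
  have [f psiE] := topdual_linear dpsi.
  have dTpsi : topdual E (adjoint T psi).
    apply: (bounded_topdual (C := C)); last first.
      by move=> y; exact: le_trans (psi1 _) (TC y).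
    by move=> a u v; rewrite /adjoint/= psiE !linearP.
  (* Poorness speaks of functions, so the adjoint functional must first be represented by some [g]
     before the choice of [P] and [N] can bound it. *)
  have [g gP] := kothe_functional_pairing K OC dTpsi.
  have := small g; rewrite -(pairing_repr_indic indP mP PI gP).
  rewrite -(pairing_repr_indic indP mN NI gP) => /(_ _)/ltW small'.
  apply: (le_trans (psiC _ erefl)); apply: (le_trans (ler_norm _)).
  have -> : psi (T x) = adjoint T psi (ind P) - adjoint T psi (ind N).
    by rewrite /adjoint/= psiE !linearB.
  apply: small'; exists (adjoint T psi) => //; exists psi => //; split => //.
  by apply: dual_norm_le => // y; rewrite mul1r.
have [x [xA Tx]] := balanced_sign K indP OC C0 TC Tsmall mA AI e0.
by have [x2 x0] := signed_indicator_rep K indP AI xA; exists x.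
Qed.
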